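(* Let $q\in\mathbb C$ with $q\ne0$, $|q|\neq 1$, and let $r,s\in\mathbb Z$ with $r\neq-1$. For $1\le i<j<k\le6$ let $$\mathsf R^{(s)}_{ijk}(\lambda)= f_{q,\lambda}\bigl(\tilde w^{(s)}_{ijk}\bigr)\,\bigl\langle\lambda\,w^{(s)}_{ijk}\bigr\rangle_{q^{r+1}}\,\mathsf F_{ijk}=\mathsf F_{ijk}\,f_{q,\lambda}\bigl(w^{(s)}_{ijk}\bigr)\,\bigl\langle\lambda\,\tilde w^{(s)}_{ijk}\bigr\rangle_{q^{r+1}},$$ where $$w^{(s)}_{ijk}=a_i^{r-s}a_j^{s-r}\,b_ib_k^{-1}a_k^{s+1},\qquad \tilde w^{(s)}_{ijk}=a_k^{s-r}\,b_ib_k^{-1}a_i^{-s-1}a_j^{s+1}.$$ Then $R=\mathsf R^{(s)}$ satisfies the tetrahedron equation $$R_{123} (\lambda) \, R_{145} (\lambda\mu) \, R_{246} (\nu) \, R_{356}(\mu) = R_{356}(\nu) \, R_{246}(\mu) \, R_{145}(\lambda\nu) \, R_{123}(\lambda)$$ provided that the invertible formal power series $f_{q,\lambda}(t)\in\mathbb C[[t]]$ either is constant or is given by $$f_{q,\lambda}(t)=f_{q,\lambda}(0)\,\Bigl\langle q^{-(r+1)\frac{\widehat m(\widehat m+1)}2}\lambda^l\,t^{\widehat m}\Bigr\rangle_{q^{-(r+1)\widehat m^2}},$$ where $\widehat m$ is a positive integer and $l\in\mathbb Z$.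
   Context: Here $\lambda,\mu,\nu\in\mathbb C$. $Q_q(6)$ is the associative unital $\mathbb C$-algebra with generators $a_i^{\pm1},b_i^{\pm1}$, $i=1,\dots,6$, and relations $a_ib_j=q^{\delta_{ij}}b_ja_i$, $a_ia_j=a_ja_i$, $b_ib_j=b_jb_i$, $a_ia_i^{-1}=a_i^{-1}a_i=1$, $b_ib_i^{-1}=b_i^{-1}b_i=1$. For $p\in\mathbb C$ nonzero with $|p|\ne1$, $\langle x\rangle_p=\sum_{n\ge 0}\frac{(-x)^n}{(1-p)(1-p^2)\cdots(1-p^n)}$ is a formal power series in $x$ (the $n=0$ term is $1$). For $1\le i<j<k\le 6$, $\mathcal F_{ijk}$ is the involutive automorphism of $Q_q(6)$ given by $a_i\mapsto a_i$, $a_j\mapsto a_ia_k$, $a_k\mapsto a_i^{-1}a_j$, $b_i\mapsto b_ib_jb_k^{-1}$, $b_j\mapsto b_k$, $b_k\mapsto b_j$, and fixing all $a_l,b_l$ with $l\notin\{i,j,k\}$. These satisfy $\mathcal F_{123}\mathcal F_{145}\mathcal F_{246}\mathcal F_{356}=\mathcal F_{356}\mathcal F_{246}\mathcal F_{145}\mathcal F_{123}$ (composition), and $\mathcal F_{ijk}$ interchanges $w^{(s)}_{ijk}$ and $\tilde w^{(s)}_{ijk}$, which commute. $\mathsf F_{ijk}$ is a formal element (generator of the outer automorphism $\mathcal F_{ijk}$) with $\mathsf F_{ijk}^2=1$ and $\mathsf F_{ijk}\,x=\mathcal F_{ijk}(x)\,\mathsf F_{ijk}$ for $x\in Q_q(6)$;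 the $\mathsf F$'s multiply as the automorphisms $\mathcal F_{ijk}$ do. The expressions are treated as formal power series in the non-commuting monomials, multiplied termwise.
   Formalization: The formal theorem additionally assumes f_{q,λμ}(0) = f_{q,λν}(0), automatic if f_{q,λ}(0) does not depend on λ; without it the tetrahedron equation fails, e.g. for f_{q,λ}(t) = 1+|λ|² constant in t, with λ=μ=1, ν=2. *)

(* Defs.v *)
(* The field of complex numbers is R[i], for R : realType. *)
From HB Require Import structures.
From mathcomp Require Import all_boot all_order all_algebra.
From mathcomp Require Import all_classical reals complex ring zify.

Set Implicit Arguments.
Unset Strict Implicit.
Unset Printing Implicit Defensive.

Import Order.TTheory GRing.Theory Num.Theory.
Local Open Scope classical_set_scope.
Local Open Scope ring_scope.

(** * Formal power series in one variable, as coefficient sequences *)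

Section PowerSeries.
Context {R : realType}.
Implicit Types (g h : nat -> R[i]) (c p : R[i]).

Definition ps_mul g h : nat -> R[i] :=
  fun n => \sum_(k < n.+1) g k * h (n - k)%N.

Definition ps_one : nat -> R[i] := fun n => (n == 0%N)%:R.

Definition ps_invertible g : Prop := exists h, ps_mul g h =1 ps_one.

Definition ps_constant g : Prop := forall n, (0 < n)%N -> g n = 0.

(** The series g(c t^m) in t, for m > 0. *)
Definition ps_at_monomial g c (m : nat) : nat -> R[i] :=
  fun n => if (m %| n)%N then g (n %/ m)%N * c ^+ (n %/ m)%N else 0.

(** The series <x>_p in x. *)
Definition qdilog p : nat -> R[i] :=
  fun n => (-1) ^+ n / \prod_(1 <= k < n.+1) (1 - p ^+ k).

End PowerSeries.

(** * Monomials of Q_q(6) and the automorphisms F_ijk *)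

(** The ordered monomials
      a_1^(x_1) ... a_6^(x_6) b_1^(y_1) ... b_6^(y_6)      (x, y in Z^6)
    form a basis of Q_q(6) (see [ta_tb] and [tmulA] below); such a monomial is
    encoded by the pair (x, y). *)
Definition mono : Type := ('rV[int]_6 * 'rV[int]_6)%type.

Definition dot (x y : 'rV[int]_6) : int := \sum_(l < 6) x 0 l * y 0 l.

Definition ebase (i : 'I_6) : 'rV[int]_6 := delta_mx 0 i.

(** Exponents of the images of the generators a_l, resp. b_l, under F_ijk:
    every a_l goes to a monomial in the a's, every b_l to one in the b's. *)
Definition Faut_a (i j k l : 'I_6) : 'rV[int]_6 :=
  if l == j then ebase i + ebase k
  else if l == k then - ebase i + ebase j
  else ebase l.

Definition Faut_b (i j k l : 'I_6) : 'rV[int]_6 :=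
  if l == i then ebase i + ebase j - ebase k
  else if l == j then ebase k
  else if l == k then ebase j
  else ebase l.

(** As the a's commute among themselves, and so do the b's, F_ijk maps ordered
    monomials to ordered monomials, without scalar factors. *)
Definition Faut (i j k : 'I_6) (x : mono) : mono :=
  (\sum_(l < 6) x.1 0 l *: Faut_a i j k l,
   \sum_(l < 6) x.2 0 l *: Faut_b i j k l).

Lemma Faut_def (i j k : 'I_6) (x : mono) : (i < j < k)%N ->
  Faut i j k x =
  (x.1 + x.1 0 j *: (ebase i - ebase j + ebase k)
       + x.1 0 k *: (- ebase i + ebase j - ebase k),
   x.2 + x.2 0 i *: (ebase j - ebase k)
       + x.2 0 j *: (ebase k - ebase j) + x.2 0 k *: (ebase j - ebase k)).
Proof.
move=> ijk; have [nij nik njk] : [/\ i != j, i != k & j != k].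
  by split; apply/eqP => e; move: ijk; rewrite e; lia.
have sel (z : 'rV[int]_6) (v : 'rV[int]_6) m :
    \sum_(l < 6) z 0 l *: ((l == m)%:R *: v) = z 0 m *: v.
  rewrite (bigD1 m) //= eqxx scale1r big1 ?addr0 // => l /negPf ->.
  by rewrite scale0r scaler0.
rewrite /Faut; congr pair.
- rewrite {2}(row_sum_delta x.1) -(sel x.1 _ j) -(sel x.1 _ k) -!big_split /=.
  apply: eq_bigr => l _; rewrite -!scalerDr; congr (_ *: _).
  rewrite /Faut_a; case: (eqVneq l j) => [->|_]; last case: (eqVneq l k) => [->|_].
  + rewrite (negPf njk) scale0r scale1r addr0 /ebase.
    by apply/rowP => m; rewrite !mxE; ring.
  + by rewrite scale0r scale1r /ebase; apply/rowP => m; rewrite !mxE; ring.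
  + by rewrite !scale0r !addr0.
- rewrite {2}(row_sum_delta x.2) -(sel x.2 _ i) -(sel x.2 _ j) -(sel x.2 _ k) -!big_split /=.
  apply: eq_bigr => l _; rewrite -!scalerDr; congr (_ *: _).
  rewrite /Faut_b; case: (eqVneq l i) => [->|_]; last case: (eqVneq l j) => [->|_];
    last case: (eqVneq l k) => [->|_].
  + rewrite (negPf nij) (negPf nik) !scale0r scale1r !addr0 /ebase.
    by apply/rowP => m; rewrite !mxE; ring.
  + rewrite (negPf njk) !scale0r scale1r addr0 addr0 /ebase.
    by apply/rowP => m; rewrite !mxE; ring.
  + by rewrite !scale0r scale1r !addr0 /ebase; apply/rowP => m; rewrite !mxE; ring.
  + by rewrite !scale0r !addr0.
Qed.

Lemma dotC x y : dot x y = dot y x.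
Proof. by apply: eq_bigr => l _; rewrite mulrC. Qed.

Lemma dotDl x y z : dot (x + y) z = dot x z + dot y z.
Proof. by rewrite -big_split; apply: eq_bigr => l _; rewrite mxE mulrDl. Qed.

Lemma dotDr x y z : dot x (y + z) = dot x y + dot x z.
Proof. by rewrite dotC dotDl !(dotC x). Qed.

Lemma dotZl (n : int) x y : dot (n *: x) y = n * dot x y.
Proof. by rewrite [RHS]mulr_sumr; apply: eq_bigr => l _; rewrite mxE mulrA. Qed.

Lemma dotZr (n : int) x y : dot x (n *: y) = n * dot x y.
Proof. by rewrite dotC dotZl dotC. Qed.

Lemma dot0l x : dot 0 x = 0.
Proof. by apply: (addrI (dot 0 x)); rewrite -dotDl !addr0. Qed.

Lemma dot0r x : dot x 0 = 0.
Proof. by rewrite dotC dot0l. Qed.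

Lemma dotNr x y : dot x (- y) = - dot x y.
Proof. by rewrite -scaleN1r dotZr mulN1r. Qed.

Lemma dotNl x y : dot (- x) y = - dot x y.
Proof. by rewrite dotC dotNr dotC. Qed.

Lemma dot_ebaser x (i : 'I_6) : dot x (ebase i) = x 0 i.
Proof.
rewrite /dot (bigD1 i) //= big1 ?addr0 => [|l /negPf nl].
  by rewrite mxE !eqxx mulr1.
by rewrite mxE nl andbF mulr0.
Qed.

Lemma dot_ebasel x (i : 'I_6) : dot (ebase i) x = x 0 i.
Proof. by rewrite dotC dot_ebaser. Qed.

Lemma dot_ebase (i j : 'I_6) : dot (ebase i) (ebase j) = (i == j)%:R.
Proof. by rewrite dot_ebaser mxE eqxx eq_sym. Qed.

(** F_ijk is an automorphism: it is additive on exponents, preserves the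
    pairing that governs the product, and is involutive. *)
Lemma FautD (i j k : 'I_6) x y : Faut i j k (x + y) = Faut i j k x + Faut i j k y.
Proof.
rewrite /Faut; congr pair; rewrite -big_split; apply: eq_bigr => l _ /=;
by rewrite mxE scalerDl.
Qed.

Lemma Faut_dot (i j k : 'I_6) x y : (i < j < k)%N ->
  dot (Faut i j k x).2 (Faut i j k y).1 = dot x.2 y.1.
Proof.
move=> ijk; have [nij nik njk] : [/\ i != j, i != k & j != k].
  by split; apply/eqP => e; move: ijk; rewrite e; lia.
rewrite !Faut_def //= !(dotDl, dotDr, dotZl, dotZr, dotNl, dotNr).
rewrite !dot_ebase !dot_ebasel !dot_ebaser !eqxx.
rewrite !(eq_sym j i, eq_sym k i, eq_sym k j) (negPf nij) (negPf nik) (negPf njk).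
by rewrite /= ?mulr0n ?mulr1n; ring.
Qed.

Lemma FautK (i j k : 'I_6) : (i < j < k)%N -> involutive (Faut i j k).
Proof.
move=> ijk [x y]; have [nij nik njk] : [/\ i != j, i != k & j != k].
  by split; apply/eqP => e; move: ijk; rewrite e; lia.
rewrite !Faut_def //=; congr pair; apply/rowP => m; rewrite !mxE !eqxx /=;
rewrite !(eq_sym j i, eq_sym k i, eq_sym k j) (negPf nij) (negPf nik) (negPf njk);
by rewrite /= ?mulr0n ?mulr1n; ring.
Qed.

(** * Monomials with coefficients *)

(** [Term c x g] is c * x * G, where c is a scalar, x an ordered monomial of
    Q_q(6), and G the formal generator of the outer automorphism g; the
    automorphisms at hand permute the ordered monomials, so g is recorded by its
    action on them.  The parameter q only selects the multiplication below. *)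
Record term (R : realType) (q : R[i]) :=
  Term { tcoef : R[i]; tmon : mono; taut : mono -> mono }.

Arguments Term {R q}.

Section Terms.
Context {R : realType} {q : R[i]}.
Implicit Types (t u v : term q) (c : R[i]).

(** From G x' = g(x') G, and b^y a^x = q^(- y.x) a^x b^y. *)
Definition tmul t u : term q :=
  let x := taut t (tmon u) in
  Term (tcoef t * tcoef u * q ^ (- dot (tmon t).2 x.1))
       (tmon t + x) (taut t \o taut u).

Definition tscale c t : term q := Term (c * tcoef t) (tmon t) (taut t).

Definition tone : term q := Term 1 0 id.

Definition texp t n : term q := iter n (tmul t) tone.

(** a_i^n, b_i^n for n in Z, and the formal element F_ijk. *)
Definition ta (i : 'I_6) (n : int) : term q := Term 1 (n *: ebase i, 0) id.
Definition tb (i : 'I_6) (n : int) : term q := Term 1 (0, n *: ebase i) id.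
Definition tF (i j k : 'I_6) : term q := Term 1 0 (Faut i j k).

Local Notation "t *t u" := (tmul t u) (at level 40, left associativity).

Lemma tmulA t u v : q != 0 ->
  {morph taut t : x y / x + y} ->
  (forall x y, dot (taut t x).2 (taut t y).1 = dot x.2 y.1) ->
  t *t (u *t v) = t *t u *t v.
Proof.
move=> q0 tD tdot; rewrite /tmul /=; congr Term; last by rewrite tD addrA.
rewrite tD dotDl dotDr tdot !opprD !expfzDr // -!mulrA; congr (_ * (_ * _)).
rewrite [RHS]mulrCA; congr (_ * _); rewrite mulrCA; congr (_ * _).
exact: mulrC.
Qed.

(** The defining relations of Q_q(6), and those of the formal elements F_ijk.
    The relations reduce every word to a scalar multiple of an ordered monomial,
    and [tmulA] shows that they impose nothing further on ordered monomials. *)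
Lemma ta_tb (i j : 'I_6) : q != 0 ->
  ta i 1 *t tb j 1 = tscale (q ^+ (i == j)) (tb j 1 *t ta i 1).
Proof.
move=> q0; rewrite /tmul /tscale /ta /tb /=; congr Term; last exact: addrC.
rewrite !scale1r dot0l dot_ebase eq_sym oppr0 expr0z !mul1r.
by case: (j == i); [rewrite expr1 exprN1 mulfV | rewrite oppr0 expr0z mulr1].
Qed.

Lemma ta_ta (i j : 'I_6) (m n : int) : ta i m *t ta j n = ta j n *t ta i m.
Proof.
rewrite /tmul /ta /=; congr Term; last exact: addrC.
by rewrite !dot0l.
Qed.

Lemma tb_tb (i j : 'I_6) (m n : int) : tb i m *t tb j n = tb j n *t tb i m.
Proof.
rewrite /tmul /tb /=; congr Term; last exact: addrC.
by rewrite !dot0r.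
Qed.

Lemma taD (i : 'I_6) (m n : int) : ta i m *t ta i n = ta i (m + n).
Proof.
rewrite /tmul /ta /=; congr Term.
  by rewrite dot0l oppr0 expr0z !mul1r.
by congr pair; rewrite ?addr0 // scalerDl.
Qed.

Lemma tbD (i : 'I_6) (m n : int) : tb i m *t tb i n = tb i (m + n).
Proof.
rewrite /tmul /tb /=; congr Term.
  by rewrite dot0r oppr0 expr0z !mul1r.
by congr pair; rewrite ?addr0 // scalerDl.
Qed.

Lemma tF_comm (i j k : 'I_6) c (x : mono) :
  tF i j k *t Term c x id = Term c (Faut i j k x) id *t tF i j k.
Proof.
rewrite /tmul /tF /=; congr Term; last by rewrite add0r addr0.
by rewrite dot0l dot0r oppr0 expr0z !mulr1 mul1r.
Qed.

Lemma tF_tF (i j k : 'I_6) : (i < j < k)%N -> tF i j k *t tF i j k = tone.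
Proof.
move=> ijk; have F0 : Faut i j k 0 = 0.
  by apply: (addrI (Faut i j k 0)); rewrite -FautD !addr0.
rewrite /tmul /tF /tone /=; congr Term.
- by rewrite dot0l oppr0 expr0z !mulr1.
- by rewrite F0 addr0.
- by apply/funext => x /=; rewrite FautK.
Qed.

End Terms.

Notation "t *t u" := (tmul t u) (at level 40, left associativity).

(** * Formal series of monomials *)

(** A formal series is a family of terms, read as the formal sum of its
    members; series are multiplied termwise. *)
Section Series.
Context {R : realType} {q : R[i]}.

Definition smul {I J : choiceType} (A : I -> term q) (B : J -> term q) :
  I * J -> term q := fun p => A p.1 *t B p.2.

Definition sterm (t : term q) : unit -> term q := fun=> t.

(** g(t), for a power series g. *)
Definition seval (g : nat -> R[i]) (t : term q) : nat -> term q :=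
  fun n => tscale (g n) (texp t n).

Definition locally_finite {I : choiceType} (A : I -> term q) : Prop :=
  forall (x : mono) (g : mono -> mono),
    finite_set [set n | [/\ tmon (A n) = x, taut (A n) = g & tcoef (A n) != 0]].

(** The coefficient of x G in the formal sum; meaningful for locally finite
    families, the finitely supported sum being 0 by convention otherwise. *)
Definition scoef {I : choiceType} (A : I -> term q)
    (x : mono) (g : mono -> mono) : R[i] :=
  \sum_(n \in [set n | tmon (A n) = x /\ taut (A n) = g]) tcoef (A n).

(** Both formal sums are well defined, and they are equal. *)
Definition series_eq {I J : choiceType} (A : I -> term q) (B : J -> term q) :
    Prop :=
  [/\ locally_finite A, locally_finite B
    & forall x g, scoef A x g = scoef B x g].

End Series.

Notation "A *s B" := (smul A B) (at level 40, left associativity).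
Notation "A =s B" := (series_eq A B) (at level 70, no associativity).

(** * The operators R_ijk *)

Section Operators.
Context {R : realType} (q : R[i]).

Definition wmon (r s : int) (i j k : 'I_6) : term q :=
  ta i (r - s) *t ta j (s - r) *t tb i 1 *t tb k (-1) *t ta k (s + 1).

Definition wtmon (r s : int) (i j k : 'I_6) : term q :=
  ta k (s - r) *t tb i 1 *t tb k (-1) *t ta i (- s - 1) *t ta j (s + 1).

(** f x is the power series f_{q,x}(t). *)
Definition Rop (f : R[i] -> nat -> R[i]) (r s : int) (i j k : 'I_6) (x : R[i]) :=
  seval (f x) (wtmon r s i j k)
  *s seval (qdilog (q ^ (r + 1))) (tscale x (wmon r s i j k))
  *s sterm (tF i j k).

Definition Rop_alt (f : R[i] -> nat -> R[i]) (r s : int) (i j k : 'I_6)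
    (x : R[i]) :=
  sterm (tF i j k)
  *s seval (f x) (wmon r s i j k)
  *s seval (qdilog (q ^ (r + 1))) (tscale x (wtmon r s i j k)).

End Operators.

(** The index n in {1, ..., 6}; 'I_6 itself is {0, ..., 5}. *)
Definition ix (n : nat) : 'I_6 := inord n.-1.

(* Main.v *)
(* In each product the F_ijk are moved to the right.  What remains on the left is
   <x><u><z><y>, and on the right <z><y><v><x>, where x, y, z are monomials times
   lambda, mu, nu with y x = p x y, x z = p z x, u = x y, v = z x and p = q^(r+1);
   moreover u commutes with z, and v with y.  Both products agree by the pentagon
   identity <y><x> = <x><x y><y>, which expresses Cauchy's q-binomial theorem.
   The arguments of f commute with all of these monomials and satisfy the same
   relations with p replaced by p^-1; their m-th powers give two further
   pentagons, in base p^(-m^2).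

   Formal sums are compared through the linear operators by which they act on
   functions of monomials, degree by degree for a grading that is positive on all
   the monomials involved; this also makes all the sums locally finite. *)
Require Import Defs.
From HB Require Import structures.
From mathcomp Require Import all_boot all_order all_algebra.
From mathcomp Require Import finmap.
From mathcomp Require Import all_classical reals complex ring zify.

Set Implicit Arguments.
Unset Strict Implicit.
Unset Printing Implicit Defensive.

Import Order.TTheory GRing.Theory Num.Theory.
Local Open Scope ring_scope.

(** The pentagon has to be applied inside longer products, but [=s] compares families over different
    index sets and is not visibly compatible with [*s]. As operators, equal formal sums become equal
    objects, and convolution of degrees makes these a semigroup, so the argument reduces to
    rewriting with a few commutation rules. Nothing is lost: acting on the indicator of a monomial
    and evaluating at the monomial 1 recovers its coefficient. The shape of f is dictated by the
    spectral parameters. If X and Y are rescaled m-th powers belonging to lambda and mu, then X Y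
    has to be the rescaled m-th power belonging to lambda mu. The factor lambda^l is multiplicative,
    and the powers of q produced by reordering then force the remaining constant
    q^(-(r+1)m(m+1)/2). *)

(** * The q-binomial theorem and the scalar form of the pentagon *)

Section QBinomial.
Context {F : fieldType} (p : F).
Hypothesis p_gen : forall n, (0 < n)%N -> p ^+ n != 1.

(** The q-Pochhammer symbol (p;p)_n, the denominator in [qdilog]. *)
Definition qfact n : F := \prod_(1 <= k < n.+1) (1 - p ^+ k).

Lemma qfactS n : qfact n.+1 = qfact n * (1 - p ^+ n.+1).
Proof. by rewrite /qfact big_nat_recr. Qed.

Lemma qfact0 : qfact 0 = 1.
Proof. by rewrite /qfact big_geq. Qed.

Lemma one_sub_expr_neq0 n : 1 - p ^+ n.+1 != 0.
Proof. by rewrite subr_eq0 eq_sym p_gen. Qed.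

Lemma qfact_neq0 n : qfact n != 0.
Proof.
elim: n => [|n IHn]; first by rewrite qfact0 oner_neq0.
by rewrite qfactS mulf_neq0 ?one_sub_expr_neq0.
Qed.

(* Cauchy's q-binomial theorem, divided by [qfact n]. *)
Lemma qbinomial x n :
  \sum_(k < n.+1) (qfact k)^-1 * (qfact (n - k))^-1 * \prod_(l < k) (x - p ^+ l)
  = x ^+ n / qfact n.
Proof.
pose P k := \prod_(l < k) (x - p ^+ l).
elim: n => [|n IHn].
  by rewrite big_ord_recl !big_ord0 /= qfact0 expr0 !invr1 !mulr1 addr0.
apply: (mulIf (one_sub_expr_neq0 n)).
have -> : x ^+ n.+1 / qfact n.+1 * (1 - p ^+ n.+1) = x ^+ n / qfact n * x.
  by rewrite qfactS exprSr; field; rewrite one_sub_expr_neq0 qfact_neq0.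
rewrite -IHn mulr_suml.
(* The q-Pascal rule, from 1 - p^(n+1) = (1 - p^k) + p^k (1 - p^(n+1-k)); each summand cancels the
   top factor of one of the two factorials. *)
have Pascal (k : 'I_n.+2) :
    (qfact k)^-1 * (qfact (n.+1 - k))^-1 * P k * (1 - p ^+ n.+1) =
    (if (0 < k)%N then (qfact k.-1)^-1 * (qfact (n.+1 - k))^-1 * P k else 0) +
    (if (k < n.+1)%N then (qfact k)^-1 * (qfact (n - k))^-1 * (p ^+ k * P k) else 0).
  case: k => [[|k] /= ltk].
    rewrite subn0 add0r subn0 qfactS qfact0 expr0.
    by field; rewrite ?oner_neq0 ?one_sub_expr_neq0 ?qfact_neq0.
  rewrite subSS; case: ltnP => [kn|kn].
    have [m ->] : exists m, n = (k.+1 + m)%N by exists (n - k.+1)%N; lia.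
    have -> : (k.+1 + m - k = m.+1)%N by lia.
    have -> : (k.+1 + m - k.+1 = m)%N by lia.
    rewrite !qfactS (_ : (k.+1 + m).+1 = (k.+1 + m.+1)%N); last by lia.
    rewrite exprD.
    have := one_sub_expr_neq0 k; have := one_sub_expr_neq0 m.
    move: (p ^+ k.+1) (p ^+ m.+1) => a b b0 a0.
    by field; rewrite ?oner_neq0 ?a0 ?b0 ?qfact_neq0.
  have -> : k = n by lia.
  rewrite subnn qfact0 qfactS addr0.
  have := one_sub_expr_neq0 n; move: (p ^+ n.+1) => a a0.
  by field; rewrite ?oner_neq0 ?one_sub_expr_neq0 ?qfact_neq0.
rewrite (eq_bigr _ (fun k _ => Pascal k)) big_split /=.
(* The first sum is shifted by one, after which P (k+1) + p^k P k = x P k. *)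
rewrite big_ord_recl /= add0r [X in _ + X]big_ord_recr /= ltnn addr0 -big_split /=.
rewrite mulr_suml; apply: eq_bigr => k _; rewrite /bump /= add1n subSS ltnS.
rewrite (leq_ord k) /P big_ord_recr /=.
by ring.
Qed.

(** Each factor is - p^l (1 - p^(k+m-l)); the powers p^l multiply to p^(k(k-1)/2). *)
Lemma prod_expr_sub k m :
  \prod_(l < k) (p ^+ (k + m) - p ^+ l) =
  (-1) ^+ k * p ^+ 'C(k, 2) * (qfact (k + m) / qfact m).
Proof.
elim: k m => [|k IHk] m.
  by rewrite big_ord0 expr0 bin_small // expr0 !mul1r divff ?qfact_neq0.
rewrite big_ord_recr /= (_ : k.+1 + m = k + m.+1)%N; last by lia.
rewrite IHk (qfactS m) binS bin1 [(-1) ^+ k.+1]exprSr !exprD.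
have := one_sub_expr_neq0 m; move: (p ^+ m.+1) => a a0.
by field; rewrite a0 qfact_neq0.
Qed.

(** The q-binomial theorem at x = p^j, where the product vanishes for k > j; this cuts the sum off
    at min(i, j). It is the comparison of the coefficients of x^i y^j in the pentagon. *)
Lemma pentagon_coef i j :
  \sum_(k < (minn i j).+1)
     (qfact (i - k))^-1 * (qfact k)^-1 * (qfact (j - k))^-1 *
     ((-1) ^+ k * p ^+ 'C(k, 2))
  = p ^+ (i * j) / (qfact i * qfact j).
Proof.
have := qbinomial (p ^+ j) i; rewrite -exprM mulnC => eq_qb.
rewrite invfM mulrA -eq_qb mulr_suml.
rewrite (big_ord_widen i.+1 (fun k => (qfact (i - k))^-1 * (qfact k)^-1 *
  (qfact (j - k))^-1 * ((-1) ^+ k * p ^+ 'C(k, 2)))); last by lia.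
rewrite big_mkcond /=; apply: eq_bigr => k _; case: ltnP => [kij|jk].
  have [m ->] : exists m, j = (k + m)%N by exists (j - k)%N; lia.
  rewrite prod_expr_sub addKn.
  by field; rewrite !qfact_neq0.
have kj : (j < k)%N by have := ltn_ord k; lia.
(* The factor with l = j is p^j - p^j. *)
by rewrite (bigD1 (Ordinal kj)) //= subrr mul0r mulr0 mul0r.
Qed.

End QBinomial.

(** * Calculus of terms without formal automorphism *)

Section PlainTerms.
Context {R : realType} {q : R[i]}.
Hypothesis q_neq0 : q != 0.
Implicit Types (t u v x y : term q) (c p : R[i]).

(** Scalar multiples of ordered monomials, that is, terms in Q_q(6) itself; for these [tmul] is
    associative without further conditions. *)
Definition plain t := taut t = id.

Lemma tmul_plainA t u v : plain t -> t *t (u *t v) = t *t u *t v.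
Proof. by move=> t_id; apply: tmulA => //; rewrite t_id. Qed.

Lemma tmul1 t : plain t -> t *t tone = t.
Proof.
case: t => c x g; rewrite /plain /tmul /= => ->; congr Term; last by rewrite addr0.
by rewrite dot0r oppr0 expr0z !mulr1.
Qed.

Lemma tone_mul t : tone *t t = t.
Proof.
case: t => c x g; rewrite /tmul /=; congr Term; last by rewrite add0r.
by rewrite dot0l oppr0 expr0z mulr1 mul1r.
Qed.

Lemma plain_mul t u : plain t -> plain u -> plain (t *t u).
Proof. by rewrite /plain /= => -> ->. Qed.

Lemma tscale_mull c t u : tscale c t *t u = tscale c (t *t u).
Proof. by rewrite /tmul /tscale /= !mulrA. Qed.

Lemma tscale_mulr c t u : t *t tscale c u = tscale c (t *t u).
Proof. by rewrite /tmul /tscale /=; congr Term; rewrite !mulrA [tcoef t * c]mulrC. Qed.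

Lemma tscale_tscale c d t : tscale c (tscale d t) = tscale (c * d) t.
Proof. by rewrite /tscale /= mulrA. Qed.

Lemma tscale1 t : tscale 1 t = t.
Proof. by case: t => c x g; rewrite /tscale /= mul1r. Qed.

Lemma plain_exp t n : plain t -> plain (texp t n).
Proof. by move=> t_id; elim: n => //= n IHn; exact: plain_mul. Qed.

Lemma texpS t n : texp t n.+1 = t *t texp t n.
Proof. by []. Qed.

Lemma texp1 t : plain t -> texp t 1 = t.
Proof. exact: tmul1. Qed.

Lemma texpD t m n : plain t -> texp t (m + n) = texp t m *t texp t n.
Proof.
move=> t_id; elim: m => [|m IHm]; first by rewrite tone_mul.
by rewrite addSn !texpS IHm tmul_plainA.
Qed.

Lemma texpM t m n : plain t -> texp t (m * n) = texp (texp t m) n.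
Proof.
by move=> t_id; elim: n => [|n IHn]; rewrite ?muln0 // mulnS texpD // IHn.
Qed.

Lemma texp_scale c t n : texp (tscale c t) n = tscale (c ^+ n) (texp t n).
Proof.
elim: n => [|n IHn]; first by rewrite expr0 tscale1.
by rewrite !texpS IHn tscale_mull tscale_mulr tscale_tscale -exprS.
Qed.

Lemma tmon_mul t u : plain t -> tmon (t *t u) = tmon t + tmon u.
Proof. by rewrite /tmul /= => ->. Qed.

Lemma tmon_exp t n : plain t -> tmon (texp t n) = tmon t *+ n.
Proof. by move=> t_id; elim: n => //= n IHn; rewrite t_id /= IHn mulrS. Qed.

Lemma texp_comm p x y i j : plain x -> plain y ->
  y *t x = tscale p (x *t y) ->
  texp y j *t texp x i = tscale (p ^+ (i * j)) (texp x i *t texp y j).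
Proof.
move=> x_id y_id yx.
have comm1 n : y *t texp x n = tscale (p ^+ n) (texp x n *t y).
  elim: n => [|n IHn]; first by rewrite expr0 tscale1 tone_mul tmul1.
  rewrite texpS tmul_plainA // yx tscale_mull -tmul_plainA // IHn tscale_mulr.
  by rewrite tscale_tscale -exprS tmul_plainA.
elim: j => [|j IHj].
  by rewrite muln0 expr0 tscale1 tone_mul tmul1 //; exact: plain_exp.
rewrite texpS -tmul_plainA // IHj tscale_mulr tmul_plainA // comm1 tscale_mull.
by rewrite tscale_tscale -exprD mulnS addnC -tmul_plainA //; exact: plain_exp.
Qed.

(** Every y has to pass all the later x, which makes n(n-1)/2 exchanges, each costing a factor p. *)
Lemma texp_mul p x y n : plain x -> plain y ->
  y *t x = tscale p (x *t y) ->
  texp (x *t y) n = tscale (p ^+ 'C(n, 2)) (texp x n *t texp y n).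
Proof.
move=> x_id y_id yx; elim: n => [|n IHn].
  by rewrite expr0 tscale1 tone_mul.
rewrite !texpS IHn tscale_mulr -tmul_plainA // [y *t (_ *t _)]tmul_plainA //.
have := texp_comm n 1 x_id y_id yx; rewrite texp1 // => ->.
rewrite tscale_mull tscale_mulr tscale_tscale muln1 binS bin1 exprD.
by rewrite -(tmul_plainA _ _ (plain_exp n x_id)) tmul_plainA.
Qed.

End PlainTerms.

(** * Graded families and their action on functions of monomials *)

Section GradedSeries.
Context {R : realType} {q : R[i]}.
Hypothesis q_neq0 : q != 0.
Context {h : mono -> int}.
Hypothesis hD : {morph h : x y / x + y}.
Implicit Types (t u : term q) (phi psi : mono -> R[i]) (d : nat) (z : mono).

Definition level {I : choiceType} (A : I -> term q) d : set I :=
  [set n | h (tmon (A n)) = d%:Z]%classic.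

(** Finiteness is asked of the index sets of each degree, not just of the nonzero coefficients, so
    that the sum in each degree runs over a finite set of indices. Nonnegative degrees make the
    condition stable under products. *)
Definition graded {I : choiceType} (A : I -> term q) : Prop :=
  [/\ forall n, plain (A n), forall n, 0 <= h (tmon (A n))
    & forall d, finite_set (level A d)].

(* The action of plain terms on functions of monomials, contravariant in the term. *)
Definition lact t phi : mono -> R[i] :=
  fun z => tcoef t * q ^ (- dot (tmon t).2 z.1) * phi (tmon t + z).

(* [fset_set] of an infinite set is empty; the levels of a graded family are finite. *)
Definition sact {I : choiceType} (A : I -> term q) d phi : mono -> R[i] :=
  fun z => \sum_(n <- fset_set (level A d)) lact (A n) phi z.

Lemma grading0 : h 0 = 0.
Proof. by apply: (addrI (h 0)); rewrite -hD !addr0. Qed.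

Lemma gradingMn x n : h (x *+ n) = h x *+ n.
Proof. by elim: n => [|n IHn]; rewrite ?grading0 // !mulrS hD IHn. Qed.

(** If phi is extended linearly to Q_q(6), then [lact t phi z] is the value of phi on the product of
    t and the monomial z; precomposition with left multiplication reverses the order. *)
Lemma lact_mul t u phi : plain t -> lact (t *t u) phi = lact u (lact t phi).
Proof.
move=> t_id; apply/funext => z; rewrite /lact /tmul /= t_id /= addrA.
rewrite dotDl dotDr !opprD !expfzDr //.
by ring.
Qed.

Lemma lactD t phi psi : lact t (phi + psi) = lact t phi + lact t psi.
Proof. by apply/funext => z; rewrite /lact !fctE mulrDr. Qed.

Lemma sactD {I : choiceType} (A : I -> term q) d :
  {morph sact A d : phi psi / phi + psi}.
Proof.
move=> phi psi; apply/funext => z; rewrite -[RHS]/(sact A d phi z + sact A d psi z) -big_split.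
by apply: eq_bigr => n _; rewrite lactD.
Qed.

Lemma level_fset {I : choiceType} (A : I -> term q) d n : graded A ->
  (n \in fset_set (level A d)) = (h (tmon (A n)) == d%:Z).
Proof.
by case=> _ _ fA; rewrite in_fset_set //; apply/idP/eqP; rewrite inE.
Qed.

Lemma grading_smul {I J : choiceType} (A : I -> term q) (B : J -> term q) p :
  graded A -> h (tmon ((A *s B) p)) = h (tmon (A p.1)) + h (tmon (B p.2)).
Proof. by case=> A1 _ _; rewrite -hD -tmon_mul. Qed.

Lemma graded_mul {I J : choiceType} (A : I -> term q) (B : J -> term q) :
  graded A -> graded B -> graded (A *s B).
Proof.
move=> gA [B1 B2 B3]; case: (gA) => A1 A2 A3; split=> [p|p|d].
- exact: plain_mul.
- by rewrite grading_smul // addr_ge0.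
(* As degrees are nonnegative, both factors of a product of degree d have degree at most d. *)
have fin (K : choiceType) (C : K -> term q) : (forall d, finite_set (level C d)) ->
    finite_set (\bigcup_(k in `I_d.+1) level C k)%classic.
  by move=> fC; apply: bigcup_finite => [|k _]; [exact: finite_II | exact: fC].
apply: (sub_finite_set _ (finite_setX (fin _ _ A3) (fin _ _ B3))) => -[i j].
rewrite /level /mkset grading_smul //= => hij; split => /=.
  by exists `|h (tmon (A i))|%N; have := A2 i; have := B2 j => /=; lia.
by exists `|h (tmon (B j))|%N; have := A2 i; have := B2 j => /=; lia.
Qed.

Lemma graded_seval (g : nat -> R[i]) t : plain t -> 0 < h (tmon t) ->
  graded (seval g t).
Proof.
move=> t_id t_gt0; split=> [n|n|d]; first exact: plain_exp.
  by rewrite /= tmon_exp // gradingMn mulrn_wge0 // ltW.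
apply: (sub_finite_set _ (finite_II d.+1)) => n.
by rewrite /level /= tmon_exp // gradingMn; nia.
Qed.

Lemma graded_sterm t : plain t -> h (tmon t) = 0 -> graded (sterm t).
Proof.
move=> t_id t0; split=> // [n|d]; first by rewrite /= t0.
exact: finite_finset.
Qed.

Lemma sact_mul {I J : choiceType} (A : I -> term q) (B : J -> term q) d phi :
  graded A -> graded B ->
  sact (A *s B) d phi = \sum_(k < d.+1) sact B (d - k) (sact A k phi).
Proof.
move=> gA gB; have gAB := graded_mul gA gB; case: (gA) => A1 A2 _; case: (gB) => B1 B2 _.
apply/funext => z; rewrite fct_sumE {1}/sact.
(* On pairs of total degree d the first degree is at most d, so [inord] does not fall back on its
   default value. *)
pose deg (p : I * J) := inord `|h (tmon (A p.1))| : 'I_d.+1.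
rewrite (partition_big deg xpredT) //=; apply: eq_bigr => k _.
transitivity (\sum_(p <- [seq (i, j) | i <- fset_set (level A k),
                                       j <- fset_set (level B (d - k))])
                 lact (A p.1 *t B p.2) phi z).
  rewrite -big_filter; apply: perm_big; apply: uniq_perm.
  - by rewrite filter_uniq ?fset_uniq.
  - by apply: allpairs_uniq => // -[? ?] [].
  move=> [i j]; rewrite mem_filter level_fset // grading_smul //=.
  apply/andP/allpairsP => [[/eqP dk /eqP hd]|[[i' j'] [+ + [-> ->]]]] /=.
    have hk : h (tmon (A i)) = k.
      by rewrite -dk inordK /=; have := A2 i; have := B2 j; lia.
    exists (i, j); split; rewrite ?level_fset //= ?hk //.
    by apply/eqP; have := ltn_ord k; lia.
  rewrite !level_fset // => /eqP hi /eqP hj; split; last first.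
    by rewrite hi hj; apply/eqP; have := ltn_ord k; lia.
  by rewrite /deg /= hi absz_nat inord_val.
rewrite big_allpairs exchange_big /=; apply: eq_bigr => j _.
rewrite [RHS]/lact mulr_sumr; apply: eq_bigr => i _.
by rewrite lact_mul.
Qed.

(** Collecting like terms: beta sends each index of A to the index of B that absorbs its
    coefficient. This is what allows families with different index sets to be identified. *)
Lemma sact_collapse {I J : choiceType} (A : I -> term q) (B : J -> term q)
    (beta : I -> J) : graded A -> graded B ->
  (forall i, tmon (A i) = tmon (B (beta i))) ->
  (forall j, tcoef (B j) = \sum_(i \in beta @^-1` [set j]%classic) tcoef (A i)) ->
  sact A = sact B.
Proof.
move=> gA gB monAB coefAB; apply/funext => d; apply/funext => phi; apply/funext => z.
rewrite /sact; set LA := fset_set _; set LB := fset_set _.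
transitivity (\sum_(i <- LA) \sum_(j <- LB | j == beta i) lact (A i) phi z).
  rewrite big_seq [RHS]big_seq; apply: eq_bigr => i; rewrite level_fset // => hi.
  by rewrite -big_filter filter_pred1_uniq ?fset_uniq ?big_seq1 // level_fset // -monAB.
rewrite (exchange_big_dep xpredT) //= [LHS]big_seq [RHS]big_seq.
apply: eq_bigr => j; rewrite level_fset // => /eqP hj; rewrite {2}/lact coefAB.
(* The whole fibre over j lies in [LA], because its members have the monomial of [B j] and hence
   degree d. *)
rewrite (fsbigE [seq i <- LA | beta i == j]) ?filter_uniq ?fset_uniq //; first last.
- move=> i /= ij; rewrite mem_filter ij eqxx level_fset // monAB ij hj eqxx.
  by [].
- by move=> i; rewrite /= mem_filter => /andP[/eqP].
rewrite big_filter_cond !mulr_suml; apply: eq_big => [i|i /eqP ->].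
  by rewrite eq_sym andb_idr // => /eqP ij; apply: mem_set.
by rewrite /lact monAB.
Qed.

Definition twist (g : mono -> mono) t : term q := Term (tcoef t) (tmon t) g.

(** The monomial 1 is encoded by 0, and a term sends the indicator of x to a function whose value
    there is its coefficient if its monomial is x, and 0 otherwise. *)
Lemma scoef_twist {I : choiceType} (A A0 : I -> term q) g x d :
  graded A0 -> (forall n, A n = twist g (A0 n)) -> h x = d%:Z ->
  scoef A x g = sact A0 d (fun y => (y == x)%:R) 0.
Proof.
move=> gA0 AE hx; rewrite /scoef /sact.
rewrite (fsbigE [seq n <- fset_set (level A0 d) | tmon (A0 n) == x]) ?filter_uniq ?fset_uniq //.
- rewrite big_filter_cond big_mkcond; apply: eq_bigr => n _.
  rewrite /lact dot0r oppr0 expr0z mulr1 addr0 AE /=.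
  case: eqVneq => nx /=; last by rewrite mulr0.
  by rewrite mulr1 ifT //; apply: mem_set; split; rewrite AE.
- by move=> n /=; rewrite mem_filter => /andP[/eqP nx _]; split; rewrite AE.
- move=> n [+ _]; rewrite AE /= => nx.
  by rewrite mem_filter nx eqxx level_fset // nx hx eqxx.
Qed.

Lemma twist_locally_finite {I : choiceType} (A A0 : I -> term q) g :
  graded A0 -> (forall n, A n = twist g (A0 n)) -> locally_finite A.
Proof.
move=> [_ A2 A3] AE x g'.
apply: (sub_finite_set _ (A3 `|h x|%N)) => n [+ _ _]; rewrite AE /= => nx.
by rewrite /level /mkset -nx; have := A2 n; lia.
Qed.

(** The way back from operators to [=s]. Coefficients at another automorphism or in negative degree
    are empty sums on both sides; all others are read off from the action. *)
Lemma series_eq_twist {I J : choiceType} (A A0 : I -> term q)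
    (B B0 : J -> term q) g :
  graded A0 -> graded B0 ->
  (forall n, A n = twist g (A0 n)) -> (forall n, B n = twist g (B0 n)) ->
  sact A0 = sact B0 -> A =s B.
Proof.
move=> gA gB AE BE AB; split=> [||x g'].
- exact: twist_locally_finite gA AE.
- exact: twist_locally_finite gB BE.
have [<-|gg] := pselect (g = g'); last first.
  by rewrite /scoef !fsbig1 // => n [_]; rewrite ?AE ?BE.
have [x_ge0|x_lt0] := leP 0 (h x).
  by rewrite !(scoef_twist (d := `|h x|%N) (x := x) (g := g) _ AE,
               scoef_twist (d := `|h x|%N) (x := x) (g := g) _ BE) // ?AB //; lia.
case: gA gB => _ A2 _ [_ B2 _].
rewrite /scoef !fsbig1 // => n [+ _].
  by rewrite BE /= => nx; have := B2 n; rewrite nx; lia.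
by rewrite AE /= => nx; have := A2 n; rewrite nx; lia.
Qed.

(** The case of [sact_collapse] in which every fibre has at most one element; indices outside the
    image of beta carry coefficient 0. *)
Lemma sact_reindex {I J : choiceType} (A : I -> term q) (B : J -> term q)
    (beta : I -> J) : graded A -> graded B -> injective beta ->
  (forall i, A i = B (beta i)) ->
  (forall j, (forall i, beta i != j) -> tcoef (B j) = 0) ->
  sact A = sact B.
Proof.
move=> gA gB beta_inj AB B0; apply: (sact_collapse (beta := beta)) => // [i|j].
  by rewrite AB.
have [[i <-]|nj] := pselect (exists i, beta i = j).
  rewrite (_ : _ @^-1` _ = [set i])%classic ?fsbig_set1 ?AB //.
  by apply/seteqP; split=> [i' /beta_inj|i' ->].
rewrite B0 => [|i]; last by apply/eqP => ij; apply: nj; exists i.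
by rewrite fsbig1 // => i ij; case: nj; exists i.
Qed.

Lemma sact_comm {I J : choiceType} (A : I -> term q) (B : J -> term q) :
  graded A -> graded B -> (forall i j, A i *t B j = B j *t A i) ->
  sact (A *s B) = sact (B *s A).
Proof.
move=> gA gB AB; apply: (sact_reindex (beta := fun p => (p.2, p.1))).
- exact: graded_mul.
- exact: graded_mul.
- by move=> [? ?] [? ?] [-> ->].
- by move=> [i j]; exact: AB.
- by move=> [j i] /(_ (i, j)); rewrite eqxx.
Qed.

Lemma sact_mul_tone {I : choiceType} (A : I -> term q) :
  graded A -> sact (A *s sterm tone) = sact A.
Proof.
move=> gA; apply: (sact_reindex (beta := fst)) => //.
- by apply: graded_mul => //; apply: graded_sterm => //; exact: grading0.
- by move=> [? []] [? []] /= ->.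
- by move=> [i []]; rewrite /smul /= tmul1 //; case: gA.
- by move=> j /(_ (j, tt)); rewrite eqxx.
Qed.

End GradedSeries.

(** * The semigroup of operators indexed by degree *)

Section OperatorSeries.
Context {R : realType}.
Implicit Types (phi psi : mono -> R[i]) (d : nat).

(** Additivity is part of the data because associativity of the convolution moves an operator
    through a sum. *)
Record opser := Opser {
  opser_fun : nat -> (mono -> R[i]) -> mono -> R[i];
  opserD : forall d, {morph opser_fun d : phi psi / phi + psi} }.

Lemma opser_eq (S T : opser) : opser_fun S = opser_fun T -> S = T.
Proof. by case: S T => S SD [T TD] /= e; subst T; congr Opser; exact: Prop_irrelevance. Qed.

Lemma opser_sum (S : opser) d n (F : nat -> mono -> R[i]) :
  opser_fun S d (\sum_(k < n) F k) = \sum_(k < n) opser_fun S d (F k).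
Proof.
apply: (big_morph (opser_fun S d)); first exact: opserD.
by apply: (addrI (opser_fun S d 0)); rewrite -opserD !addr0.
Qed.

Lemma omul_subproof (S T : opser) d :
  {morph (fun phi => \sum_(k < d.+1) opser_fun T (d - k) (opser_fun S k phi)) :
     phi psi / phi + psi}.
Proof.
by move=> phi psi; rewrite -big_split; apply: eq_bigr => k _; rewrite !opserD.
Qed.

Definition omul (S T : opser) : opser := Opser (omul_subproof S T).

(** Both bracketings sum over all ways to split d into three degrees; G k l is the summand with S in
    degree k, T in degree l and U in the remaining degree. The substitution m = k + l exchanges the
    two groupings. *)
Lemma omulA : associative omul.
Proof.
move=> S T U; apply: opser_eq; apply/funext => d; apply/funext => phi /=.
pose G k l := opser_fun U (d - (l + k)) (opser_fun T l (opser_fun S k phi)).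
transitivity (\sum_(k < d.+1) \sum_(m < d.+1 | (k <= m)%N) G k (m - k)%N).
  apply: eq_bigr => k _.
  rewrite -(big_geq_mkord k d.+1 xpredT (fun m => G k (m - k)%N)) -[X in index_iota X]add0n.
  rewrite big_addn subSn ?leq_ord // big_mkord; apply: eq_bigr => l _.
  by rewrite /G addnK addnC subnDA.
rewrite (exchange_big_dep xpredT) //=; apply: eq_bigr => m _.
rewrite (opser_sum U _ _ (fun k => opser_fun T (m - k) (opser_fun S k phi))).
rewrite (big_ord_widen_cond d.+1 xpredT
  (fun k => opser_fun U (d - m) (opser_fun T (m - k) (opser_fun S k phi)))) //.
by apply: eq_big => k // km; rewrite /G subnK.
Qed.

Definition ops {q : R[i]} {h : mono -> int} {I : choiceType} (A : I -> term q) :=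
  Opser (sactD (h := h) A).

Lemma ops_mul {q : R[i]} {h : mono -> int} {I J : choiceType} (A : I -> term q)
    (B : J -> term q) : q != 0 -> {morph h : x y / x + y} ->
  graded (h := h) A -> graded (h := h) B ->
  ops (h := h) (A *s B) = omul (ops (h := h) A) (ops (h := h) B).
Proof.
move=> q_neq0 hD gA gB; apply: opser_eq; apply/funext => d; apply/funext => phi.
exact: sact_mul.
Qed.

End OperatorSeries.

(** * Rearrangements in a semigroup *)

Section SemigroupIdentities.
Context {T : Type} (op : T -> T -> T).
Hypothesis opA : associative op.
Local Notation "x * y" := (op x y).

Lemma interchange a b c d : b * c = c * b -> (a * b) * (c * d) = (a * c) * (b * d).
Proof. by move=> bc; rewrite -!opA [b * (c * d)]opA bc -opA. Qed.

Lemma comm_mul a b c : a * c = c * a -> b * c = c * b -> (a * b) * c = c * (a * b).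
Proof. by move=> ac bc; rewrite -opA bc opA ac -opA. Qed.

(** Used twice: to separate the series f from the quantum dilogarithms, and then the constants f(0)
    from the normalised series. *)
Lemma interchange4 a1 a2 a3 a4 b1 b2 b3 b4 :
  b1 * a2 = a2 * b1 -> b1 * a3 = a3 * b1 -> b1 * a4 = a4 * b1 ->
  b2 * a3 = a3 * b2 -> b2 * a4 = a4 * b2 -> b3 * a4 = a4 * b3 ->
  (a1 * b1) * (a2 * b2) * (a3 * b3) * (a4 * b4) =
  (a1 * a2 * a3 * a4) * (b1 * b2 * b3 * b4).
Proof.
move=> h12 h13 h14 h23 h24 h34.
rewrite (interchange _ _ h12) (interchange _ _ (comm_mul h13 h23)).
by rewrite (interchange _ _ (comm_mul (comm_mul h14 h24) h34)).
Qed.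

(* [x * u * z * y = x * z * u * y = z * v * x * u * y = z * v * y * x] *)
Lemma two_pentagons x y z u v :
  y * x = x * u * y -> x * z = z * v * x -> u * z = z * u -> y * v = v * y ->
  x * u * z * y = z * y * v * x.
Proof.
by move=> yx xz uz yv; rewrite -(opA x u) uz opA xz -!opA (opA y v) yv -opA yx -!opA.
Qed.

End SemigroupIdentities.

(** * The pentagon identity and reductions of the series f *)

Section Pentagon.
Context {R : realType} {q : R[i]}.
Hypothesis q_neq0 : q != 0.
Context {h : mono -> int}.
Hypothesis hD : {morph h : x y / x + y}.
Implicit Types (x y t : term q) (p : R[i]).

Lemma plain_seval (g : nat -> R[i]) t n : plain t -> plain (seval g t n).
Proof. exact: plain_exp. Qed.

Lemma plain_smul {I J : choiceType} (A : I -> term q) (B : J -> term q) n :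
  plain (A n.1) -> plain (B n.2) -> plain ((A *s B) n).
Proof. exact: plain_mul. Qed.

Lemma tmon_smul {I J : choiceType} (A : I -> term q) (B : J -> term q) n :
  plain (A n.1) -> tmon ((A *s B) n) = tmon (A n.1) + tmon (B n.2).
Proof. exact: tmon_mul. Qed.

Lemma tmon_seval (g : nat -> R[i]) t n : plain t -> tmon (seval g t n) = tmon t *+ n.
Proof. exact: tmon_exp. Qed.

Lemma tcoef_scale (c : R[i]) t : tcoef (tscale c t) = c * tcoef t.
Proof. by []. Qed.

Lemma qdilogE p n : qdilog p n = (-1) ^+ n / qfact p n.
Proof. by []. Qed.

(** Up to a scalar, x^a (x y)^k y^b is the monomial y^(k+b) x^(a+k). The triples with a given image
    have equal monomials, and their coefficients add up by [pentagon_coef]. *)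
Lemma qdilog_pentagon p x y : (forall n, (0 < n)%N -> p ^+ n != 1) ->
  plain x -> plain y -> 0 < h (tmon x) -> 0 < h (tmon y) ->
  y *t x = tscale p (x *t y) ->
  ops (h := h) (seval (qdilog p) y *s seval (qdilog p) x) =
  ops (h := h) (seval (qdilog p) x *s seval (qdilog p) (x *t y) *s seval (qdilog p) y).
Proof.
move=> p_gen x_id y_id x_gt0 y_gt0 yx.
have xy_id := plain_mul x_id y_id.
have xy_gt0 : 0 < h (tmon (x *t y)) by rewrite tmon_mul // hD addr_gt0.
apply: opser_eq; rewrite /=; apply/esym.
pose beta (n : nat * nat * nat) := (n.1.2 + n.2, n.1.1 + n.1.2)%N.
apply: (sact_collapse (beta := beta)).
- by do ?[apply: graded_mul | apply: graded_seval].
- by do ?[apply: graded_mul | apply: graded_seval].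
- move=> [[i k] j]; rewrite !tmon_smul /= ?tmon_seval ?tmon_mul //; first last;
    do ?[exact: plain_seval | apply: plain_smul].
  by rewrite !mulrnDr mulrnDl [X in X + _ = _]addrA -[LHS]addrA addrC.
move=> [j i].
(* The fibre of beta over (j, i), parametrised by the exponent k of x y. *)
pose n_ k : nat * nat * nat := ((i - k, k), (j - k))%N.
rewrite (reindex_fsbig n_ `I_(minn i j).+1%classic); last first.
  split=> [k /= kij|k l _ _ [_ -> _] //|[[i' k] j'] [jE iE]].
    by rewrite /beta /=; congr pair; lia.
  exists k => /=; first by lia.
  by rewrite /n_ -jE -iE /= addnK addKn.
rewrite -fsbig_ord.
(* Both sides are expressed through the common ordering x^i y^j. *)
pose W := tcoef (texp x i *t texp y j).
transitivity ((-1) ^+ (i + j) * (p ^+ (i * j) / (qfact p i * qfact p j)) * W).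
  rewrite -[LHS]/(tcoef (tscale _ (texp y j) *t tscale _ (texp x i))).
  rewrite tscale_mull tscale_mulr (texp_comm q_neq0 i j x_id y_id yx).
  rewrite !tcoef_scale !qdilogE exprD -/W; field; rewrite !qfact_neq0 //.
rewrite -pentagon_coef // mulr_sumr mulr_suml; apply: eq_bigr => -[k /= ltk] _.
rewrite -[RHS]/(tcoef (tscale _ (texp x _) *t tscale _ (texp _ _) *t tscale _ (texp y _))).
rewrite (texp_mul q_neq0 k x_id y_id yx).
rewrite !(tscale_mull, tscale_mulr, tscale_tscale).
rewrite (tmul_plainA q_neq0); last exact: plain_exp.
rewrite -texpD // subnK; last by lia.
rewrite -(tmul_plainA q_neq0); last exact: plain_exp.
rewrite -texpD // subnKC; last by lia.
rewrite tcoef_scale -/W !qdilogE.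
(* The two exponents differ by 2k. The sign (-1)^k of the middle factor is the one appearing in
   [pentagon_coef]. *)
have -> : (-1) ^+ (i + j) = (-1) ^+ (i - k) * (-1) ^+ (j - k) :> R[i].
  have [[i' ->] [j' ->]] : (exists i', i = k + i')%N /\ (exists j', j = k + j')%N.
    by split; [exists (i - k)%N | exists (j - k)%N]; lia.
  by rewrite !addKn addnACA addnn -mul2n exprD exprM sqrrN !expr1n mul1r exprD.
by field; rewrite !qfact_neq0.
Qed.

Lemma graded_scalar (c : R[i]) : graded (h := h) (sterm (tscale c (tone (q := q)))).
Proof. by apply: graded_sterm => //; exact: grading0. Qed.

Lemma smul_scalar {I : choiceType} (A : I -> term q) (c : R[i]) n :
  (sterm (tscale c (tone (q := q))) *s A) n = tscale c (A n.2).
Proof. by rewrite /smul tscale_mull tone_mul. Qed.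

(** Only exponents divisible by m have nonzero coefficients, so k can be sent to m k; the constant
    term is split off as a scalar series. *)
Lemma ops_seval_at_monomial (f g : nat -> R[i]) c m t :
  plain t -> 0 < h (tmon t) -> (0 < m)%N ->
  (forall n, f n = f 0%N * ps_at_monomial g c m n) ->
  ops (h := h) (seval f t) =
  ops (h := h) (sterm (tscale (f 0%N) tone) *s seval g (tscale c (texp t m))).
Proof.
move=> t_id t_gt0 m_gt0 fE; apply/esym/opser_eq => /=.
apply: (sact_reindex (beta := fun n => m * n.2)%N).
- apply: graded_mul => //; first exact: graded_scalar.
  apply: graded_seval => //; first exact: plain_exp.
  by rewrite /= tmon_exp // gradingMn // pmulrn_lgt0.
- exact: graded_seval.
- by move=> [[] j] [[] k] /= /eqP; rewrite eqn_pmul2l // => /eqP ->.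
- move=> n; rewrite smul_scalar -[RHS]/(tscale (f (m * n.2)%N) (texp t (m * n.2))).
  rewrite /seval texp_scale !tscale_tscale.
  by rewrite (fE (m * _)%N) /ps_at_monomial dvdn_mulr // mulKn // mulrA -texpM.
- move=> n nm; rewrite tcoef_scale fE /ps_at_monomial ifF ?mulr0 ?mul0r //.
  by apply/negP => /dvdnP[k nk]; have := nm (tt, k); rewrite nk mulnC eqxx.
Qed.

Lemma ops_seval_constant (f : nat -> R[i]) t :
  plain t -> 0 < h (tmon t) -> ps_constant f ->
  ops (h := h) (seval f t) = ops (h := h) (sterm (tscale (f 0%N) (tone (q := q)))).
Proof.
move=> t_id t_gt0 f_const; apply/esym/opser_eq => /=.
apply: (sact_reindex (beta := fun=> 0%N)).
- exact: graded_scalar.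
- exact: graded_seval.
- by move=> [] [].
- by move=> n.
- move=> [|n] nn; first by have := nn tt.
  by rewrite tcoef_scale f_const ?mul0r.
Qed.

End Pentagon.

(** * Moving automorphisms through products *)

Section Automorphisms.
Context {R : realType} {q : R[i]}.
Implicit Types (t u : term q) (g : mono -> mono).

Definition gact g t : term q := Term (tcoef t) (g (tmon t)) (taut t).

(** The scalar in [tmul] depends only on this pairing, so the two conditions make [gact g]
    multiplicative on plain terms. *)
Definition mono_morph g : Prop :=
  {morph g : x y / x + y} /\ (forall x y, dot (g x).2 (g y).1 = dot x.2 y.1).

Lemma mono_morph_Faut (i j k : 'I_6) : (i < j < k)%N -> mono_morph (Faut i j k).
Proof. by move=> ijk; split=> [|x y]; [exact: FautD | exact: Faut_dot]. Qed.

Lemma mono_morph_comp g g' : mono_morph g -> mono_morph g' -> mono_morph (g \o g').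
Proof.
move=> [gD gdot] [gD' gdot']; split=> x y /=; first by rewrite gD' gD.
by rewrite gdot gdot'.
Qed.

Lemma mul_twist g t : plain t -> t *t Term 1 0 g = twist g t.
Proof.
case: t => c x a; rewrite /plain /= => ->; rewrite /tmul /twist /=; congr Term; last by rewrite addr0.
by rewrite dot0r oppr0 expr0z !mulr1.
Qed.

(** The rule G u = g(u) G, applied once to collect both formal generators on the right. *)
Lemma twist_mul g g' t u : plain t -> plain u ->
  twist g t *t twist g' u = twist (g \o g') (t *t gact g u).
Proof. by case: t u => c x a [d y b]; rewrite /plain /= => -> ->. Qed.

Lemma gact_mul g t u : mono_morph g -> plain t -> plain u ->
  gact g (t *t u) = gact g t *t gact g u.
Proof.
move=> [gD gdot]; case: t u => c x a [d y b]; rewrite /plain /= => -> ->.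
by rewrite /gact /tmul /= gD gdot.
Qed.

Lemma gact_tone g : mono_morph g -> gact g tone = tone.
Proof.
by case=> gD _; rewrite /gact /tone; congr Term; apply: (addrI (g 0)); rewrite -gD !addr0.
Qed.

Lemma gact_exp g t n : mono_morph g -> plain t -> gact g (texp t n) = texp (gact g t) n.
Proof.
move=> g_morph t_id; elim: n => [|n IHn]; first exact: gact_tone.
by rewrite !texpS gact_mul // ?IHn //; exact: plain_exp.
Qed.

Lemma gact_seval g (f : nat -> R[i]) t n : mono_morph g -> plain t ->
  gact g (seval f t n) = seval f (gact g t) n.
Proof. by move=> g_morph t_id; rewrite /seval -gact_exp. Qed.

End Automorphisms.

(** * The operators with the formal generator removed *)

Section Operators.
Context {R : realType} {q : R[i]}.
Hypothesis q_neq0 : q != 0.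
Implicit Types (w t : term q) (f : R[i] -> nat -> R[i]) (r s : int).

(** The factor [sterm tone] stands in place of F and keeps the index set of [Rop], so that the two
    families can be compared index by index. *)
Definition Rcore f r x w t :=
  seval (f x) t *s seval (qdilog (q ^ (r + 1))) (tscale x w) *s sterm tone.

Lemma plain_Rcore f r x w t n : plain w -> plain t -> plain (Rcore f r x w t n).
Proof. by move=> w_id t_id; do ?[apply: plain_smul | apply: plain_seval]. Qed.

Lemma Rop_twist f r s i j k x n :
  Rop q f r s i j k x n =
  twist (Faut i j k) (Rcore f r x (wmon q r s i j k) (wtmon q r s i j k) n).
Proof.
rewrite /Rop /Rcore /smul /sterm /tF mul_twist ?tmul1 //;
by apply: plain_mul; apply: plain_seval.
Qed.

Lemma gact_Rcore g f r x w t n : mono_morph g -> plain w -> plain t ->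
  gact g (Rcore f r x w t n) = Rcore f r x (gact g w) (gact g t) n.
Proof.
move=> g_morph w_id t_id; rewrite /Rcore /smul /sterm !gact_mul ?gact_tone //;
  do ?[exact: plain_seval | apply: plain_mul].
by rewrite !gact_seval.
Qed.

Lemma smul_Rcore_twist {I : choiceType} (A A0 : I -> term q) g g' f r x w t
    (B : nat * nat * unit -> term q) n :
  mono_morph g -> plain w -> plain t ->
  (forall m, plain (A0 m)) -> (forall m, A m = twist g (A0 m)) ->
  (forall m, B m = twist g' (Rcore f r x w t m)) ->
  (A *s B) n = twist (g \o g') ((A0 *s Rcore f r x (gact g w) (gact g t)) n).
Proof.
move=> g_morph w_id t_id A0_id AE BE; rewrite /smul AE BE twist_mul ?gact_Rcore //.
exact: plain_Rcore.
Qed.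

Context {h : mono -> int}.
Hypothesis hD : {morph h : x y / x + y}.

Lemma graded_Rcore f r x w t : plain w -> plain t ->
  0 < h (tmon w) -> 0 < h (tmon t) -> graded (h := h) (Rcore f r x w t).
Proof.
move=> w_id t_id w_gt0 t_gt0.
do ?apply: graded_mul => //; do ?exact: graded_seval.
by apply: graded_sterm => //; exact: grading0.
Qed.

Lemma ops_Rcore f r x w t : plain w -> plain t ->
  0 < h (tmon w) -> 0 < h (tmon t) ->
  ops (h := h) (Rcore f r x w t) =
  omul (ops (h := h) (seval (f x) t))
       (ops (h := h) (seval (qdilog (q ^ (r + 1))) (tscale x w))).
Proof.
move=> w_id t_id w_gt0 t_gt0; rewrite -ops_mul //; do ?exact: graded_seval.
apply: opser_eq; apply: sact_mul_tone => //.
by apply: graded_mul => //; exact: graded_seval.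
Qed.

Lemma ops_comm {I J : choiceType} (A : I -> term q) (B : J -> term q) :
  graded (h := h) A -> graded (h := h) B -> (forall i j, A i *t B j = B j *t A i) ->
  omul (ops (h := h) A) (ops (h := h) B) = omul (ops (h := h) B) (ops (h := h) A).
Proof.
move=> gA gB AB; rewrite -!ops_mul //; apply: opser_eq; exact: sact_comm.
Qed.

Lemma texp_commute t u i j : plain t -> plain u -> t *t u = u *t t ->
  texp t i *t texp u j = texp u j *t texp t i.
Proof.
move=> t_id u_id tu; have := texp_comm (p := 1) q_neq0 j i u_id t_id.
by rewrite !tscale1 expr1n tscale1 => ->.
Qed.

Lemma ops_seval_comm (g g' : nat -> R[i]) t u : plain t -> plain u ->
  0 < h (tmon t) -> 0 < h (tmon u) -> t *t u = u *t t ->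
  omul (ops (h := h) (seval g t)) (ops (h := h) (seval g' u)) =
  omul (ops (h := h) (seval g' u)) (ops (h := h) (seval g t)).
Proof.
move=> t_id u_id t_gt0 u_gt0 tu; apply: ops_comm; do ?exact: graded_seval.
move=> i j; rewrite !(tscale_mull, tscale_mulr) texp_commute // !tscale_tscale.
by rewrite mulrC.
Qed.

Lemma ops_scalar_comm {I : choiceType} (A : I -> term q) c :
  graded (h := h) A ->
  omul (ops (h := h) A) (ops (h := h) (sterm (tscale c (tone (q := q))))) =
  omul (ops (h := h) (sterm (tscale c (tone (q := q))))) (ops (h := h) A).
Proof.
move=> gA; apply: ops_comm => //; first exact: graded_scalar.
by move=> i j; rewrite tscale_mull tscale_mulr tone_mul tmul1 //; case: gA.
Qed.

Lemma ops_scalar_mul c d :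
  omul (ops (h := h) (sterm (tscale c (tone (q := q)))))
       (ops (h := h) (sterm (tscale d (tone (q := q))))) =
  ops (h := h) (sterm (tscale (c * d) (tone (q := q)))).
Proof.
rewrite -ops_mul //; do ?exact: graded_scalar.
apply: opser_eq; apply: (sact_reindex (beta := fst)) => //.
- by apply: graded_mul => //; exact: graded_scalar.
- exact: graded_scalar.
- by move=> [[] []] [[] []].
- by move=> [i j]; rewrite smul_scalar tscale_tscale.
- by move=> j /(_ (j, tt)); rewrite eqxx.
Qed.

End Operators.

(** * Powers of monomials that commute up to a power of q *)

Section Generic.
Context {R : realType} {q : R[i]}.
Hypothesis q_neq0 : q != 0.
Implicit Types (x y z t : term q).

(** Origin of the constant in f. Reordering gives X Y = c(a) c(b) q^(k m^2) y^m x^m, while (y x)^m =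
    q^(k m(m-1)/2) y^m x^m. Since m^2 = m(m+1)/2 + m(m-1)/2, the factor q^(-k m(m+1)/2) in c makes X
    Y the rescaled m-th power belonging to a b. *)
Lemma texp_pentagon (k l : int) (m : nat) (a b : R[i]) x y :
  plain x -> plain y -> x *t y = tscale (q ^ k) (y *t x) ->
  let c e := q ^ (- k * ((m * (m + 1)) %/ 2)%N%:Z) * e ^ l in
  let X := tscale (c a) (texp x m) in
  let Y := tscale (c b) (texp y m) in
  Y *t X = tscale (q ^ (- k * (m ^ 2)%N%:Z)) (X *t Y) /\
  X *t Y = tscale (c (a * b)) (texp (y *t x) m).
Proof.
move=> x_id y_id xy c X Y.
pose u := q ^ (k * ((m * (m + 1)) %/ 2)%N); pose v := q ^ (k * 'C(m, 2)).
have u0 : u != 0 by rewrite expfz_neq0.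
have v0 : v != 0 by rewrite expfz_neq0.
have sqr : (m * m = m * (m + 1) %/ 2 + 'C(m, 2))%N.
  rewrite divn2 addn1 [(m * m.+1)%N]mulnC -(bin2 m.+1) binS bin1.
  by elim: (m) => // n IHn; rewrite binS bin1; lia.
have cE e : c e = u^-1 * e ^ l by rewrite /c mulNr -invr_expz.
have XY : X *t Y = tscale (c a * c b * (u * v)) (texp y m *t texp x m).
  rewrite /X /Y tscale_mull tscale_mulr !tscale_tscale (texp_comm q_neq0 m m y_id x_id xy).
  by rewrite tscale_tscale exprnP exprz_exp sqr PoszD mulrDr expfzDr.
split; rewrite XY.
  rewrite /X /Y tscale_mull tscale_mulr !tscale_tscale; congr tscale.
  rewrite -mulnn sqr mulNr -invr_expz PoszD mulrDr expfzDr // -/u -/v.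
  by field; rewrite u0 v0.
rewrite (texp_mul q_neq0 m y_id x_id xy) tscale_tscale; congr tscale.
rewrite !cE expfzMl exprnP exprz_exp -/v.
by field.
Qed.
Hypothesis q_norm : `|q| != 1.

Lemma exprz_neq1 (k : int) : k != 0 -> q ^ k != 1.
Proof.
have expn_neq1 n : q ^+ n.+1 != 1.
  apply: contra q_norm => /eqP qn.
  by rewrite -(pexpr_eq1 (n := n.+1)) // -normrX qn normr1.
by case: k => [[|n]|n] // _; [exact: expn_neq1 | rewrite NegzE -invr_expz invr_eq1; exact: expn_neq1].
Qed.

Lemma exprz_generic (k : int) n : k != 0 -> (0 < n)%N -> (q ^ k) ^+ n != 1.
Proof. by move=> k0 n_gt0; rewrite exprnP exprz_exp exprz_neq1 // mulf_neq0 //; lia. Qed.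

End Generic.

(** * The equation for abstract monomials *)

Section Tetrahedron.
Context {R : realType} {q : R[i]}.
Hypothesis q_neq0 : q != 0.
Hypothesis q_norm : `|q| != 1.
Context {h : mono -> int}.
Hypothesis hD : {morph h : x y / x + y}.
Implicit Types (t u x y z : term q).

Definition positive t := plain t /\ 0 < h (tmon t).

Lemma positive_mul t u : positive t -> positive u -> positive (t *t u).
Proof.
move=> [t_id t_gt0] [u_id u_gt0]; split; first exact: plain_mul.
by rewrite tmon_mul // hD addr_gt0.
Qed.

Lemma positive_exp t m : positive t -> (0 < m)%N -> positive (texp t m).
Proof.
move=> [t_id t_gt0] m_gt0; split; first exact: plain_exp.
by rewrite tmon_exp // gradingMn // pmulrn_lgt0.
Qed.

Lemma commute_mulr t u v : plain t -> plain u -> plain v ->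
  t *t u = u *t t -> t *t v = v *t t -> t *t (u *t v) = (u *t v) *t t.
Proof.
move=> t_id u_id v_id tu tv.
by rewrite tmul_plainA // tu -tmul_plainA // tv tmul_plainA.
Qed.

Local Notation ops := (ops (h := h)).
Local Notation E p t := (ops (seval (qdilog p) t)).

Lemma ops_mul4 {I1 I2 I3 I4 : choiceType} (A1 : I1 -> term q) (A2 : I2 -> term q)
    (A3 : I3 -> term q) (A4 : I4 -> term q) :
  graded (h := h) A1 -> graded (h := h) A2 -> graded (h := h) A3 ->
  graded (h := h) A4 ->
  ops (A1 *s A2 *s A3 *s A4) = omul (omul (omul (ops A1) (ops A2)) (ops A3)) (ops A4).
Proof. by move=> *; rewrite !ops_mul //; do ?apply: graded_mul. Qed.

(** The primed copies admit arguments that are equal to the required products without being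
    syntactically the same. *)
Lemma qdilog_four_term p x y z x' y' z' u' v' :
  (forall n, (0 < n)%N -> p ^+ n != 1) ->
  positive x -> positive y -> positive z ->
  y *t x = tscale p (x *t y) -> x *t z = tscale p (z *t x) ->
  x *t y *t z = z *t (x *t y) -> y *t (z *t x) = z *t x *t y ->
  x' = x -> y' = y -> z' = z -> u' = x *t y -> v' = z *t x ->
  omul (omul (omul (E p x) (E p u')) (E p z)) (E p y) =
  omul (omul (omul (E p z') (E p y')) (E p v')) (E p x').
Proof.
move=> p_gen x_pos y_pos z_pos yx xz uz yv -> -> -> -> ->.
have [u_id u_gt0] := positive_mul x_pos y_pos.
have [v_id v_gt0] := positive_mul z_pos x_pos.
move: x_pos y_pos z_pos => [x_id x_gt0] [y_id y_gt0] [z_id z_gt0].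
have pentagon s t : positive s -> positive t -> t *t s = tscale p (s *t t) ->
    omul (E p t) (E p s) = omul (omul (E p s) (E p (s *t t))) (E p t).
  move=> s_pos t_pos ts; have [[s_id s_gt0] [t_id t_gt0]] := (s_pos, t_pos).
  have [st_id st_gt0] := positive_mul s_pos t_pos.
  rewrite -!ops_mul //; do ?[exact: graded_seval | apply: graded_mul => //].
  exact: qdilog_pentagon.
apply: two_pentagons; first exact: omulA.
- exact: pentagon.
- exact: pentagon.
- exact: ops_seval_comm.
- exact: ops_seval_comm.
Qed.

(** For the tilde monomials the products are taken in the opposite order, ut = yt xt against u = x
    y, because their exchange factor is inverted. *)
Lemma core_tetrahedron (r : int) (la mu nu : R[i]) (f : R[i] -> nat -> R[i])
    x y z u v xt yt zt ut vt :
  r != -1 ->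
  f (la * mu) 0%N = f (la * nu) 0%N ->
  (forall e, ps_constant (f e)) \/
  (exists (m : nat) (l : int), (0 < m)%N /\
     forall e n,
       f e n = f e 0%N *
         ps_at_monomial (qdilog (q ^ (- (r + 1) * (m ^ 2)%N%:Z)))
           (q ^ (- (r + 1) * ((m * (m + 1)) %/ 2)%N%:Z) * e ^ l) m n) ->
  positive x -> positive y -> positive z ->
  positive xt -> positive yt -> positive zt ->
  y *t x = tscale (q ^ (r + 1)) (x *t y) ->
  x *t z = tscale (q ^ (r + 1)) (z *t x) ->
  u = x *t y -> v = z *t x -> u *t z = z *t u -> y *t v = v *t y ->
  xt *t yt = tscale (q ^ (r + 1)) (yt *t xt) ->
  zt *t xt = tscale (q ^ (r + 1)) (xt *t zt) ->
  ut = yt *t xt -> vt = xt *t zt -> ut *t zt = zt *t ut -> yt *t vt = vt *t yt ->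
  (forall s t, List.In s [:: x; y; z] -> List.In t [:: xt; yt; zt] ->
     s *t t = t *t s) ->
  sact (h := h)
    (Rcore f r la x xt *s Rcore f r (la * mu) u ut *s Rcore f r nu z zt
       *s Rcore f r mu y yt) =
  sact (h := h)
    (Rcore f r nu z zt *s Rcore f r mu y yt *s Rcore f r (la * nu) v vt
       *s Rcore f r la x xt).
Proof.
move=> r_neq f_norm f_form x_pos y_pos z_pos xt_pos yt_pos zt_pos.
move=> yx xz -> -> uz yv xyt zxt -> -> uzt yvt comm.
have xy_pos := positive_mul x_pos y_pos; have zx_pos := positive_mul z_pos x_pos.
have yxt_pos := positive_mul yt_pos xt_pos; have xzt_pos := positive_mul xt_pos zt_pos.
have r1_neq0 : r + 1 != 0 by rewrite addr_eq0.
have gr g t : positive t -> graded (h := h) (seval g t).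
  by case=> t_id t_gt0; exact: graded_seval.
have grR e w t : positive w -> positive t -> graded (h := h) (Rcore f r e w t).
  by move=> [w_id w_gt0] [t_id t_gt0]; exact: graded_Rcore.
suff : ops (Rcore f r la x xt *s Rcore f r (la * mu) (x *t y) (yt *t xt)
              *s Rcore f r nu z zt *s Rcore f r mu y yt) =
       ops (Rcore f r nu z zt *s Rcore f r mu y yt
              *s Rcore f r (la * nu) (z *t x) (xt *t zt) *s Rcore f r la x xt).
  by move/(congr1 opser_fun).
have opsR e w t : positive w -> positive t -> ops (Rcore f r e w t) =
    omul (ops (seval (f e) t)) (ops (seval (qdilog (q ^ (r + 1))) (tscale e w))).
  by move=> [w_id w_gt0] [t_id t_gt0]; exact: ops_Rcore.
have opsC g g' e w t : positive w -> positive t -> w *t t = t *t w ->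
    omul (ops (seval g (tscale e w))) (ops (seval g' t)) =
    omul (ops (seval g' t)) (ops (seval g (tscale e w))).
  move=> [w_id w_gt0] [t_id t_gt0] wt; apply: ops_seval_comm => //.
  by rewrite tscale_mull tscale_mulr wt.
have [x_id y_id z_id] : [/\ plain x, plain y & plain z].
  by case: x_pos y_pos z_pos => ? _ [? _] [? _].
have [xt_id yt_id zt_id] : [/\ plain xt, plain yt & plain zt].
  by case: xt_pos yt_pos zt_pos => ? _ [? _] [? _].
have comml s t t' : plain s -> plain t -> plain t' -> s *t t = t *t s ->
    s *t t' = t' *t s -> s *t (t *t t') = t *t t' *t s by exact: commute_mulr.
have commr s s' t : plain s -> plain s' -> plain t -> s *t t = t *t s ->
    s' *t t = t *t s' -> s *t s' *t t = t *t (s *t s').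
  by move=> *; apply/esym/commute_mulr.
have xxt : x *t xt = xt *t x by apply: comm => /=; tauto.
have xyt' : x *t yt = yt *t x by apply: comm => /=; tauto.
have xzt : x *t zt = zt *t x by apply: comm => /=; tauto.
have yxt : y *t xt = xt *t y by apply: comm => /=; tauto.
have yyt : y *t yt = yt *t y by apply: comm => /=; tauto.
have yzt' : y *t zt = zt *t y by apply: comm => /=; tauto.
have zxt' : z *t xt = xt *t z by apply: comm => /=; tauto.
have zyt : z *t yt = yt *t z by apply: comm => /=; tauto.
have zzt : z *t zt = zt *t z by apply: comm => /=; tauto.
have p_gen n : (0 < n)%N -> (q ^ (r + 1)) ^+ n != 1 by exact: exprz_generic.
rewrite !ops_mul4; do ?exact: grR.
rewrite !opsR //.
(* All tilde monomials commute with all the others, so each side factors into its f part and its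
   dilogarithm part. *)
rewrite !(interchange4 omulA); do ?apply: opsC => //;
  do ?[apply: comml => // | apply: commr => //].
congr omul; last first.
  (* With the parameters absorbed into x, y and z, the products x y and z x acquire exactly lambda
     mu and nu lambda. *)
  apply: (qdilog_four_term p_gen (x := tscale la x) (y := tscale mu y)
    (z := tscale nu z)) => //; rewrite ?tscale_mull ?tscale_mulr ?tscale_tscale.
  - by rewrite yx !tscale_tscale; congr tscale; ring.
  - by rewrite xz !tscale_tscale; congr tscale; ring.
  - by rewrite !(tscale_mull, tscale_mulr, tscale_tscale) uz; congr tscale; ring.
  - by rewrite !(tscale_mull, tscale_mulr, tscale_tscale) yv; congr tscale; ring.
  - by [].
  - by rewrite mulrC.
have scalars : f la 0%N * f (la * mu) 0%N * f nu 0%N * f mu 0%N =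
    f nu 0%N * f mu 0%N * f (la * nu) 0%N * f la 0%N by rewrite f_norm; ring.
case: f_form => [f_const|[m [l [m_gt0 fE]]]].
  have seval_const e t : positive t ->
      ops (seval (f e) t) = ops (sterm (tscale (f e 0%N) (tone (q := q)))).
    by move=> [t_id t_gt0]; exact: ops_seval_constant.
  by rewrite !seval_const // !ops_scalar_mul // scalars.
pose P := q ^ (- (r + 1) * (m ^ 2)%N%:Z).
pose c e := q ^ (- (r + 1) * ((m * (m + 1)) %/ 2)%N%:Z) * e ^ l.
have P_gen n : (0 < n)%N -> P ^+ n != 1.
  by apply: exprz_generic => //; rewrite mulf_neq0 // ?oppr_eq0 //; lia.
have seval_f e t : positive t -> ops (seval (f e) t) =
    omul (ops (sterm (tscale (f e 0%N) (tone (q := q))))) (E P (tscale (c e) (texp t m))).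
  move=> t_pos; have [t_id t_gt0] := t_pos.
  rewrite (ops_seval_at_monomial q_neq0 hD t_id t_gt0 m_gt0 (fE e)) ops_mul //.
    exact: graded_scalar.
  by apply: gr; exact: positive_exp.
have scalC e t c' : positive t ->
    omul (E P (tscale e (texp t m))) (ops (sterm (tscale c' (tone (q := q))))) =
    omul (ops (sterm (tscale c' (tone (q := q))))) (E P (tscale e (texp t m))).
  by move=> t_pos; apply: ops_scalar_comm => //; apply: gr; exact: positive_exp.
rewrite !seval_f // !(interchange4 omulA); do ?exact: scalC.
rewrite !ops_scalar_mul // scalars; congr omul.
have [pentXY XY] := texp_pentagon q_neq0 l m la mu xt_id yt_id xyt.
have [pentZX ZX] := texp_pentagon q_neq0 l m nu la zt_id xt_id zxt.
(* In base P the rescaled powers satisfy the relations in the same order as x, y, z, so the same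
   identity applies. *)
apply: (qdilog_four_term P_gen (x := tscale (c la) (texp xt m))
    (y := tscale (c mu) (texp yt m)) (z := tscale (c nu) (texp zt m))) => //;
  do ?exact: positive_exp.
- rewrite XY !tscale_mull !tscale_mulr (texp_commute q_neq0 m m _ _ uzt) //; last first.
    exact: plain_mul.
  by rewrite !tscale_tscale mulrC.
- rewrite ZX !tscale_mull !tscale_mulr (texp_commute q_neq0 m m _ _ yvt) //; last first.
    exact: plain_mul.
  by rewrite !tscale_tscale mulrC.
- by rewrite ZX mulrC.
Qed.
End Tetrahedron.

(** * Coordinates for exponent vectors and the four automorphisms *)

Definition row6 (a b c d e f : int) : 'rV[int]_6 :=
  \row_l nth 0 [:: a; b; c; d; e; f] l.

Lemma row6P (x y : 'rV[int]_6) :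
  (forall l, (0 < l <= 6)%N -> x 0 (ix l) = y 0 (ix l)) -> x = y.
Proof.
move=> xy; apply/rowP => l; have := xy l.+1 (ltn_ord l).
by rewrite /ix /= inord_val.
Qed.

Lemma row6_ix a b c d e f l : (0 < l <= 6)%N ->
  row6 a b c d e f 0 (ix l) = nth 0 [:: a; b; c; d; e; f] l.-1.
Proof. by move=> l6; rewrite mxE inordK //; lia. Qed.

Lemma ebase_ix k l : (0 < k <= 6)%N -> (0 < l <= 6)%N ->
  ebase (ix k) 0 (ix l) = (k == l)%:R.
Proof.
move=> k6 l6; rewrite mxE eqxx /= eq_sym -val_eqE /= !inordK; [|lia..].
by congr (_%:R); lia.
Qed.

Lemma row6_eta (x : 'rV[int]_6) :
  x = row6 (x 0 (ix 1)) (x 0 (ix 2)) (x 0 (ix 3)) (x 0 (ix 4)) (x 0 (ix 5)) (x 0 (ix 6)).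
Proof. by apply: row6P => -[|[|[|[|[|[|[|//]]]]]]] // _; rewrite row6_ix. Qed.

Lemma dot_row6 a b c d e f a' b' c' d' e' f' :
  dot (row6 a b c d e f) (row6 a' b' c' d' e' f') =
  a * a' + b * b' + c * c' + d * d' + e * e' + f * f'.
Proof. by rewrite /dot !big_ord_recr big_ord0 /= !mxE /= add0r. Qed.

Lemma row6D a b c d e f a' b' c' d' e' f' :
  row6 a b c d e f + row6 a' b' c' d' e' f' =
  row6 (a + a') (b + b') (c + c') (d + d') (e + e') (f + f').
Proof. by apply: row6P => -[|[|[|[|[|[|[|//]]]]]]] // _; rewrite mxE !row6_ix. Qed.

Lemma ix_lt (i j k : nat) : (0 < i < j)%N -> (j < k <= 6)%N -> (ix i < ix j < ix k)%N.
Proof. by move=> ij jk; rewrite /= !inordK; lia. Qed.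

Lemma rowD (x y : 'rV[int]_6) l : (x + y) 0 l = x 0 l + y 0 l.
Proof. by rewrite mxE. Qed.

Lemma rowN (x : 'rV[int]_6) l : (- x) 0 l = - x 0 l.
Proof. by rewrite mxE. Qed.

Lemma rowZ c (x : 'rV[int]_6) l : (c *: x) 0 l = c * x 0 l.
Proof. by rewrite mxE. Qed.

Ltac row6_ring := apply: row6P => -[|[|[|[|[|[|[|//]]]]]]] // _;
  rewrite /= !(rowD, rowN, rowZ) ?ebase_ix // ?row6_ix //=; ring.

Lemma Faut123 a1 a2 a3 a4 a5 a6 b1 b2 b3 b4 b5 b6 :
  Faut (ix 1) (ix 2) (ix 3) (row6 a1 a2 a3 a4 a5 a6, row6 b1 b2 b3 b4 b5 b6) =
  (row6 (a1 + a2 - a3) a3 a2 a4 a5 a6, row6 b1 (b1 + b3) (b2 - b1) b4 b5 b6).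
Proof.
rewrite Faut_def ?ix_lt // !row6_ix //; congr pair; row6_ring.
Qed.

Lemma Faut145 a1 a2 a3 a4 a5 a6 b1 b2 b3 b4 b5 b6 :
  Faut (ix 1) (ix 4) (ix 5) (row6 a1 a2 a3 a4 a5 a6, row6 b1 b2 b3 b4 b5 b6) =
  (row6 (a1 + a4 - a5) a2 a3 a5 a4 a6, row6 b1 b2 b3 (b1 + b5) (b4 - b1) b6).
Proof.
rewrite Faut_def ?ix_lt // !row6_ix //; congr pair; row6_ring.
Qed.

Lemma Faut246 a1 a2 a3 a4 a5 a6 b1 b2 b3 b4 b5 b6 :
  Faut (ix 2) (ix 4) (ix 6) (row6 a1 a2 a3 a4 a5 a6, row6 b1 b2 b3 b4 b5 b6) =
  (row6 a1 (a2 + a4 - a6) a3 a6 a5 a4, row6 b1 b2 b3 (b2 + b6) b5 (b4 - b2)).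
Proof.
rewrite Faut_def ?ix_lt // !row6_ix //; congr pair; row6_ring.
Qed.

Lemma Faut356 a1 a2 a3 a4 a5 a6 b1 b2 b3 b4 b5 b6 :
  Faut (ix 3) (ix 5) (ix 6) (row6 a1 a2 a3 a4 a5 a6, row6 b1 b2 b3 b4 b5 b6) =
  (row6 a1 a2 (a3 + a5 - a6) a4 a6 a5, row6 b1 b2 b3 b4 (b3 + b6) (b5 - b3)).
Proof.
rewrite Faut_def ?ix_lt // !row6_ix //; congr pair; row6_ring.
Qed.

Lemma Faut_tetrahedron :
  Faut (ix 1) (ix 2) (ix 3) \o Faut (ix 1) (ix 4) (ix 5) \o
    Faut (ix 2) (ix 4) (ix 6) \o Faut (ix 3) (ix 5) (ix 6) =
  Faut (ix 3) (ix 5) (ix 6) \o Faut (ix 2) (ix 4) (ix 6) \o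
    Faut (ix 1) (ix 4) (ix 5) \o Faut (ix 1) (ix 2) (ix 3).
Proof.
apply/funext => -[x y]; rewrite (row6_eta x) (row6_eta y) /=.
rewrite !(Faut123, Faut145, Faut246, Faut356).
by congr (row6 _ _ _ _ _ _, row6 _ _ _ _ _ _); ring.
Qed.

(** * The monomials w in ordered form *)

Section Monomials.
Context {R : realType} {q : R[i]}.
Implicit Types (r s : int).

Lemma mono_add (x y x' y' : 'rV[int]_6) :
  ((x, y) + (x', y') : mono) = (x + x', y + y').
Proof. by []. Qed.

(** Ordering w moves b_k^-1 past a_k^(s+1), and ordering the tilde monomial moves b_i past
    a_i^(-s-1); both yield the scalar q^(s+1), which the automorphisms preserve. *)
Definition qmon s (x y : 'rV[int]_6) : term q := Term (q ^ (s + 1)) (x, y) id.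

Lemma wmonE r s (i j k : 'I_6) : (i < j < k)%N -> wmon q r s i j k =
  qmon s ((r - s) *: ebase i + (s - r) *: ebase j + (s + 1) *: ebase k)
         (ebase i - ebase k).
Proof.
move=> ijk; have [nij nik njk] : [/\ i != j, i != k & j != k].
  by split; apply/eqP => e; move: ijk; rewrite e; lia.
rewrite /wmon /qmon /tmul /=; congr Term; last first.
  by rewrite !mono_add; congr pair; rewrite ?(addr0, add0r, scale1r, scaleN1r).
rewrite !(dotDl, dotDr, dotZl, dotZr, dotNl, dotNr, dot0l, dot0r) !dot_ebase.
rewrite !eqxx (negPf nik) /= ?(mulr0n, mulr1n) ?mulr0 ?mul0r ?addr0 ?add0r ?oppr0 ?expr0z ?mul1r ?mulr1.
by congr (q ^ _); ring.
Qed.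

Lemma wtmonE r s (i j k : 'I_6) : (i < j < k)%N -> wtmon q r s i j k =
  qmon s ((- s - 1) *: ebase i + (s + 1) *: ebase j + (s - r) *: ebase k)
         (ebase i - ebase k).
Proof.
move=> ijk; have [nij nik njk] : [/\ i != j, i != k & j != k].
  by split; apply/eqP => e; move: ijk; rewrite e; lia.
rewrite /wtmon /qmon /tmul /=; congr Term; last first.
  rewrite !mono_add; congr pair; rewrite ?(addr0, add0r, scale1r, scaleN1r) //.
  by rewrite -addrA addrC.
rewrite !(dotDl, dotDr, dotZl, dotZr, dotNl, dotNr, dot0l, dot0r) !dot_ebase.
rewrite !eqxx !(eq_sym k) (negPf nij) (negPf nik) (negPf njk) /= ?(mulr0n, mulr1n) ?mulr0 ?mul0r ?addr0 ?add0r ?oppr0 ?expr0z ?mul1r ?mulr1.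
by rewrite ?mul1r ?mulr1; congr (q ^ _); ring.
Qed.

Lemma gact_wmon r s (i j k : 'I_6) : (i < j < k)%N ->
  gact (Faut i j k) (wmon q r s i j k) = wtmon q r s i j k.
Proof.
move=> ijk; have [nij nik njk] : [/\ i != j, i != k & j != k].
  by split; apply/eqP => e; move: ijk; rewrite e; lia.
rewrite wmonE // wtmonE // /gact /qmon Faut_def //=; congr Term; congr pair;
  apply/rowP => m; rewrite !mxE !eqxx /= !(eq_sym j i, eq_sym k i, eq_sym k j);
  by rewrite (negPf nij) (negPf nik) (negPf njk) /= ?(mulr0n, mulr1n); ring.
Qed.

Lemma gact_wtmon r s (i j k : 'I_6) : (i < j < k)%N ->
  gact (Faut i j k) (wtmon q r s i j k) = wmon q r s i j k.
Proof.
by move=> ijk; rewrite -gact_wmon // /gact /= FautK //.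
Qed.

Local Notation W := (wmon q).
Local Notation Wt := (wtmon q).
Local Notation F123 := (Faut (ix 1) (ix 2) (ix 3)).
Local Notation F145 := (Faut (ix 1) (ix 4) (ix 5)).
Local Notation F246 := (Faut (ix 2) (ix 4) (ix 6)).
Local Notation F356 := (Faut (ix 3) (ix 5) (ix 6)).

Ltac row6_compute := rewrite ?(wmonE, wtmonE) ?ix_lt //; congr qmon; row6_ring.

Lemma wmon123E r s : W r s (ix 1) (ix 2) (ix 3) =
  qmon s (row6 (r - s) (s - r) (s + 1) 0 0 0) (row6 1 0 (-1) 0 0 0).
Proof. row6_compute. Qed.

Lemma wmon145E r s : W r s (ix 1) (ix 4) (ix 5) =
  qmon s (row6 (r - s) 0 0 (s - r) (s + 1) 0) (row6 1 0 0 0 (-1) 0).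
Proof. row6_compute. Qed.

Lemma wmon246E r s : W r s (ix 2) (ix 4) (ix 6) =
  qmon s (row6 0 (r - s) 0 (s - r) 0 (s + 1)) (row6 0 1 0 0 0 (-1)).
Proof. row6_compute. Qed.

Lemma wmon356E r s : W r s (ix 3) (ix 5) (ix 6) =
  qmon s (row6 0 0 (r - s) 0 (s - r) (s + 1)) (row6 0 0 1 0 0 (-1)).
Proof. row6_compute. Qed.

Lemma wtmon123E r s : Wt r s (ix 1) (ix 2) (ix 3) =
  qmon s (row6 (- s - 1) (s + 1) (s - r) 0 0 0) (row6 1 0 (-1) 0 0 0).
Proof. row6_compute. Qed.

Lemma wtmon145E r s : Wt r s (ix 1) (ix 4) (ix 5) =
  qmon s (row6 (- s - 1) 0 0 (s + 1) (s - r) 0) (row6 1 0 0 0 (-1) 0).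
Proof. row6_compute. Qed.

Lemma wtmon246E r s : Wt r s (ix 2) (ix 4) (ix 6) =
  qmon s (row6 0 (- s - 1) 0 (s + 1) 0 (s - r)) (row6 0 1 0 0 0 (-1)).
Proof. row6_compute. Qed.

Lemma wtmon356E r s : Wt r s (ix 3) (ix 5) (ix 6) =
  qmon s (row6 0 0 (- s - 1) 0 (s + 1) (s - r)) (row6 0 0 1 0 0 (-1)).
Proof. row6_compute. Qed.

Lemma gact_qmon g s x y : gact g (qmon s x y) = qmon s (g (x, y)).1 (g (x, y)).2.
Proof. by rewrite /gact /qmon /=; case: (g _). Qed.

Hypothesis q_neq0 : q != 0.

Lemma qmon_comm s x y x' y' k : dot y' x - dot y x' = k ->
  qmon s x y *t qmon s x' y' = tscale (q ^ k) (qmon s x' y' *t qmon s x y).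
Proof.
move=> <-; rewrite /tmul /tscale /=; congr Term; last exact: addrC.
by rewrite mulrCA -[q ^ (_ - _) * _]expfzDr //; congr (_ * q ^ _); ring.
Qed.

Lemma qmon_commute s x y x' y' : dot y' x = dot y x' ->
  qmon s x y *t qmon s x' y' = qmon s x' y' *t qmon s x y.
Proof.
by move=> yx; rewrite (qmon_comm s (k := 0)) ?yx ?subrr // expr0z tscale1.
Qed.

(** Under this condition the reordering factor cancels one of the two scalars q^(s+1), so the
    product has the normalisation of [qmon] again. *)
Lemma qmon_mul s x y x' y' : dot y x' = s + 1 ->
  qmon s x y *t qmon s x' y' = qmon s (x + x') (y + y').
Proof.
move=> yx; rewrite /qmon /tmul /= yx; congr Term.
by rewrite -mulrA -expfzDr // subrr expr0z mulr1.
Qed.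

End Monomials.

(** * Images of the monomials under the partial products of automorphisms *)

Section Orbits.
Context {R : realType} {q : R[i]}.
Implicit Types (r s : int).
Local Notation W := (wmon q).
Local Notation Wt := (wtmon q).
Local Notation F123 := (Faut (ix 1) (ix 2) (ix 3)).
Local Notation F145 := (Faut (ix 1) (ix 4) (ix 5)).
Local Notation F246 := (Faut (ix 2) (ix 4) (ix 6)).
Local Notation F356 := (Faut (ix 3) (ix 5) (ix 6)).

Definition wmonsE := (@wmon123E R q, @wmon145E R q, @wmon246E R q, @wmon356E R q,
  @wtmon123E R q, @wtmon145E R q, @wtmon246E R q, @wtmon356E R q).

Definition FautsE := (Faut123, Faut145, Faut246, Faut356).

Ltac orbit_compute := rewrite !wmonsE !gact_qmon /comp !FautsE /=;
  by congr (qmon _ (row6 _ _ _ _ _ _) (row6 _ _ _ _ _ _)); ring.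

(** The last factor on the right-hand side thus has the same arguments x as the first factor on the
    left. *)
Lemma wmon123_fix r s :
  gact (F356 \o F246 \o F145) (W r s (ix 1) (ix 2) (ix 3)) = W r s (ix 1) (ix 2) (ix 3) /\
  gact (F356 \o F246 \o F145) (Wt r s (ix 1) (ix 2) (ix 3)) = Wt r s (ix 1) (ix 2) (ix 3).
Proof. split; orbit_compute. Qed.

(** Matches the third factor on the left with the first on the right, both with parameter nu; this
    is z. *)
Lemma wmon246_356 r s :
  gact (F123 \o F145) (W r s (ix 2) (ix 4) (ix 6)) = W r s (ix 3) (ix 5) (ix 6) /\
  gact (F123 \o F145) (Wt r s (ix 2) (ix 4) (ix 6)) = Wt r s (ix 3) (ix 5) (ix 6).
Proof. split; orbit_compute. Qed.

(** Matches the fourth factor on the left with the second on the right, both with parameter mu; this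
    is y. *)
Lemma wmon356_246 r s :
  gact (F123 \o F145 \o F246) (W r s (ix 3) (ix 5) (ix 6)) = gact F356 (W r s (ix 2) (ix 4) (ix 6)) /\
  gact (F123 \o F145 \o F246) (Wt r s (ix 3) (ix 5) (ix 6)) = gact F356 (Wt r s (ix 2) (ix 4) (ix 6)).
Proof. split; orbit_compute. Qed.

Lemma gact_wmon246 r s :
  gact F356 (W r s (ix 2) (ix 4) (ix 6)) =
    qmon s (row6 0 (r - s) (- s - 1) (s - r) (s + 1) 0) (row6 0 1 0 0 (-1) 0) /\
  gact F356 (Wt r s (ix 2) (ix 4) (ix 6)) =
    qmon s (row6 0 (- s - 1) (r - s) (s + 1) (s - r) 0) (row6 0 1 0 0 (-1) 0).
Proof. split; orbit_compute. Qed.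

Lemma gact_wmon145 r s :
  gact F123 (W r s (ix 1) (ix 4) (ix 5)) =
    qmon s (row6 (r - s) 0 0 (s - r) (s + 1) 0) (row6 1 1 (-1) 0 (-1) 0) /\
  gact F123 (Wt r s (ix 1) (ix 4) (ix 5)) =
    qmon s (row6 (- s - 1) 0 0 (s + 1) (s - r) 0) (row6 1 1 (-1) 0 (-1) 0).
Proof. split; orbit_compute. Qed.

Lemma gact2_wmon145 r s :
  gact (F356 \o F246) (W r s (ix 1) (ix 4) (ix 5)) =
    qmon s (row6 (r - s) (s - r) (r + 1) 0 (s - r) (s + 1)) (row6 1 0 0 0 0 (-1)) /\
  gact (F356 \o F246) (Wt r s (ix 1) (ix 4) (ix 5)) =
    qmon s (row6 (- s - 1) (s + 1) (- r - 1) 0 (s + 1) (s - r)) (row6 1 0 0 0 0 (-1)).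
Proof. split; orbit_compute. Qed.

(* Takes the values 1 on x, y, z and 2 on u, v. *)
Definition weight (x : mono) : int := dot x.2 (row6 2 1 1 0 0 0).

Lemma weightD : {morph weight : x y / x + y}.
Proof. by move=> x y; rewrite /weight dotDl. Qed.

End Orbits.

(** * The two forms of R and the tetrahedron equation *)

Section TetrahedronEquation.
Context {R : realType} {q : R[i]}.
Hypothesis q_neq0 : q != 0.
Hypothesis q_norm : `|q| != 1.
Local Notation F123 := (Faut (ix 1) (ix 2) (ix 3)).
Local Notation F145 := (Faut (ix 1) (ix 4) (ix 5)).
Local Notation F246 := (Faut (ix 2) (ix 4) (ix 6)).
Local Notation F356 := (Faut (ix 3) (ix 5) (ix 6)).

(** Moving F to the right through the second form exchanges w and its tilde partner. *)
Lemma Rop_Rop_alt (f : R[i] -> nat -> R[i]) (r s : int) (i j k : 'I_6) (x : R[i]) :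
  (i < j < k)%N -> Rop q f r s i j k x =s Rop_alt q f r s i j k x.
Proof.
(* The exponent of b_i is 1 in both monomials, so it is a positive grading. *)
move=> ijk; pose h (y : mono) := y.2 0 i.
have hD : {morph h : y z / y + z} by move=> y z; rewrite /h /= rowD.
have nik : i == k = false by apply/eqP => e; move: ijk; rewrite e; lia.
have w_gt0 : 0 < h (tmon (wmon q r s i j k)).
  by rewrite wmonE // /h /= rowD rowN !mxE !eqxx /= nik.
have wt_gt0 : 0 < h (tmon (wtmon q r s i j k)).
  by rewrite wtmonE // /h /= rowD rowN !mxE !eqxx /= nik.
have F_morph := mono_morph_Faut ijk.
pose A := seval (f x) (wtmon q r s i j k).
pose B := seval (qdilog (q ^ (r + 1))) (tscale x (wmon q r s i j k)).
have gA : graded (h := h) A by exact: graded_seval.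
have gB : graded (h := h) B by exact: graded_seval.
have gT : graded (h := h) (sterm (tone (q := q))).
  by apply: graded_sterm => //; exact: grading0.
apply: (series_eq_twist q_neq0 (h := h) (A0 := A *s B *s sterm tone)
         (B0 := sterm tone *s A *s B) (g := Faut i j k)).
- by do ?apply: graded_mul.
- by do ?apply: graded_mul.
- by move=> n; exact: Rop_twist.
- move=> [[[] n] n']; rewrite /Rop_alt /smul /sterm /tF tone_mul.
  have twist_one (g : mono -> mono) : Term 1 0 g = twist g (tone (q := q)) by [].
  have plain_twist (t : term q) : plain t -> t = twist id t.
    by case: t => c y a; rewrite /plain /= => ->.
  rewrite [seval (f x) _ n]plain_twist; last exact: plain_exp.
  rewrite [seval (qdilog _) _ n']plain_twist; last exact: plain_exp.
  rewrite twist_one twist_mul //; last exact: plain_exp.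
  rewrite tone_mul gact_seval // gact_wmon //.
  rewrite twist_mul //; do ?exact: plain_exp.
  by rewrite gact_seval // [gact _ (tscale _ _)](_ : _ = tscale x (wmon q r s i j k)) //
    -(gact_wtmon r s ijk).
- apply: (sact_reindex (beta := fun n => ((tt, n.1.1), n.1.2))) => //.
  + by do ?apply: graded_mul.
  + by do ?apply: graded_mul.
  + by move=> [[n n'] []] [[m m'] []] /= [-> ->].
  + move=> [[n n'] []]; rewrite /smul /sterm tone_mul tmul1 //.
    by apply: plain_mul; exact: plain_exp.
  + by move=> [[[] n] n'] /(_ (n, n', tt)); rewrite eqxx.
Qed.

Lemma Rop4_twist (f : R[i] -> nat -> R[i]) (r s : int)
    (i1 j1 k1 i2 j2 k2 i3 j3 k3 i4 j4 k4 : 'I_6) (e1 e2 e3 e4 : R[i]) n :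
  (i1 < j1 < k1)%N -> (i2 < j2 < k2)%N -> (i3 < j3 < k3)%N ->
  let R_ := Rop q f r s in
  let w := wmon q r s in let wt := wtmon q r s in
  let g1 := Faut i1 j1 k1 in
  let g2 := g1 \o Faut i2 j2 k2 in
  let g3 := g2 \o Faut i3 j3 k3 in
  (R_ i1 j1 k1 e1 *s R_ i2 j2 k2 e2 *s R_ i3 j3 k3 e3 *s R_ i4 j4 k4 e4) n =
  twist (g3 \o Faut i4 j4 k4)
    ((Rcore f r e1 (w i1 j1 k1) (wt i1 j1 k1)
      *s Rcore f r e2 (gact g1 (w i2 j2 k2)) (gact g1 (wt i2 j2 k2))
      *s Rcore f r e3 (gact g2 (w i3 j3 k3)) (gact g2 (wt i3 j3 k3))
      *s Rcore f r e4 (gact g3 (w i4 j4 k4)) (gact g3 (wt i4 j4 k4))) n).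
Proof.
move=> ijk1 ijk2 ijk3 R_ w wt g1 g2 g3.
have g1_morph : mono_morph g1 by exact: mono_morph_Faut.
have g2_morph : mono_morph g2 by apply: mono_morph_comp => //; exact: mono_morph_Faut.
have g3_morph : mono_morph g3 by apply: mono_morph_comp => //; exact: mono_morph_Faut.
have step (I : choiceType) (A A0 : I -> term q) g i j k e :
    mono_morph g -> (forall m, plain (A0 m)) -> (forall m, A m = twist g (A0 m)) ->
    forall m, (A *s R_ i j k e) m = twist (g \o Faut i j k)
      ((A0 *s Rcore f r e (gact g (w i j k)) (gact g (wt i j k))) m).
  by move=> g_morph A0_id AE m; apply: smul_Rcore_twist => // m'; exact: Rop_twist.
have C1_id m : plain (Rcore f r e1 (w i1 j1 k1) (wt i1 j1 k1) m) by exact: plain_Rcore.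
have C2_id m : plain (Rcore f r e2 (gact g1 (w i2 j2 k2)) (gact g1 (wt i2 j2 k2)) m).
  exact: plain_Rcore.
have C3_id m : plain (Rcore f r e3 (gact g2 (w i3 j3 k3)) (gact g2 (wt i3 j3 k3)) m).
  exact: plain_Rcore.
apply: (step) => // [m|].
  exact: (plain_smul (plain_smul (C1_id _) (C2_id _)) (C3_id _)).
apply: (step) => // [m|].
  exact: (plain_smul (C1_id _) (C2_id _)).
by apply: (step) => // m; exact: Rop_twist.
Qed.

(** Positivity is returned along with the identity, since the passage from operators back to
    coefficients needs every factor to be graded. *)
Lemma qmon_tetrahedron (r s : int) (la mu nu : R[i]) (f : R[i] -> nat -> R[i]) :
  r != -1 ->
  f (la * mu) 0%N = f (la * nu) 0%N ->
  (forall e, ps_constant (f e)) \/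
  (exists (m : nat) (l : int), (0 < m)%N /\
    forall e n,
      f e n = f e 0%N *
        ps_at_monomial (qdilog (q ^ (- (r + 1) * (m ^ 2)%N%:Z)))
          (q ^ (- (r + 1) * ((m * (m + 1)) %/ 2)%N%:Z) * e ^ l) m n) ->
  let x := qmon s (row6 (r - s) (s - r) (s + 1) 0 0 0) (row6 1 0 (-1) 0 0 0) in
  let y := qmon s (row6 0 (r - s) (- s - 1) (s - r) (s + 1) 0) (row6 0 1 0 0 (-1) 0) in
  let z := qmon s (row6 0 0 (r - s) 0 (s - r) (s + 1)) (row6 0 0 1 0 0 (-1)) in
  let u := qmon s (row6 (r - s) 0 0 (s - r) (s + 1) 0) (row6 1 1 (-1) 0 (-1) 0) in
  let v := qmon s (row6 (r - s) (s - r) (r + 1) 0 (s - r) (s + 1)) (row6 1 0 0 0 0 (-1)) in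
  let xt := qmon s (row6 (- s - 1) (s + 1) (s - r) 0 0 0) (row6 1 0 (-1) 0 0 0) in
  let yt := qmon s (row6 0 (- s - 1) (r - s) (s + 1) (s - r) 0) (row6 0 1 0 0 (-1) 0) in
  let zt := qmon s (row6 0 0 (- s - 1) 0 (s + 1) (s - r)) (row6 0 0 1 0 0 (-1)) in
  let ut := qmon s (row6 (- s - 1) 0 0 (s + 1) (s - r) 0) (row6 1 1 (-1) 0 (-1) 0) in
  let vt := qmon s (row6 (- s - 1) (s + 1) (- r - 1) 0 (s + 1) (s - r))
                   (row6 1 0 0 0 0 (-1)) in
  let pos (t : term q) := positive (h := weight) t in
  [/\ [/\ pos x, pos y & pos z], [/\ pos xt, pos yt & pos zt],
      pos u /\ pos v, pos ut /\ pos vt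
    & sact (h := weight)
        (Rcore f r la x xt *s Rcore f r (la * mu) u ut *s Rcore f r nu z zt
           *s Rcore f r mu y yt) =
      sact (h := weight)
        (Rcore f r nu z zt *s Rcore f r mu y yt *s Rcore f r (la * nu) v vt
           *s Rcore f r la x xt)].
Proof.
move=> r_neq f_norm f_form x y z u v xt yt zt ut vt pos.
(* The weight sees only the b exponents, which each tilde monomial shares with its partner; one
   grading therefore serves both kinds. *)
have posE a b : 0 < dot b (row6 2 1 1 0 0 0) -> pos (qmon s a b) by [].
have x_pos : pos x by apply: posE; rewrite dot_row6.
have y_pos : pos y by apply: posE; rewrite dot_row6.
have z_pos : pos z by apply: posE; rewrite dot_row6.
have xt_pos : pos xt by apply: posE; rewrite dot_row6.
have yt_pos : pos yt by apply: posE; rewrite dot_row6.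
have zt_pos : pos zt by apply: posE; rewrite dot_row6.
split.
- by split.
- by split.
- by split; apply: posE; rewrite dot_row6.
- by split; apply: posE; rewrite dot_row6.
have yx : y *t x = tscale (q ^ (r + 1)) (x *t y).
  by apply: (qmon_comm q_neq0); rewrite !dot_row6; ring.
have xz : x *t z = tscale (q ^ (r + 1)) (z *t x).
  by apply: (qmon_comm q_neq0); rewrite !dot_row6; ring.
have xyt : xt *t yt = tscale (q ^ (r + 1)) (yt *t xt).
  by apply: (qmon_comm q_neq0); rewrite !dot_row6; ring.
have zxt : zt *t xt = tscale (q ^ (r + 1)) (xt *t zt).
  by apply: (qmon_comm q_neq0); rewrite !dot_row6; ring.
have uz : u *t z = z *t u.
  by apply: (qmon_commute q_neq0); rewrite !dot_row6; ring.
have yv : y *t v = v *t y.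
  by apply: (qmon_commute q_neq0); rewrite !dot_row6; ring.
have uzt : ut *t zt = zt *t ut.
  by apply: (qmon_commute q_neq0); rewrite !dot_row6; ring.
have yvt : yt *t vt = vt *t yt.
  by apply: (qmon_commute q_neq0); rewrite !dot_row6; ring.
have uE : u = x *t y.
  rewrite (qmon_mul q_neq0) ?row6D; last by rewrite dot_row6; ring.
  by congr (qmon _ (row6 _ _ _ _ _ _) (row6 _ _ _ _ _ _)); ring.
have vE : v = z *t x.
  rewrite (qmon_mul q_neq0) ?row6D; last by rewrite dot_row6; ring.
  by congr (qmon _ (row6 _ _ _ _ _ _) (row6 _ _ _ _ _ _)); ring.
have utE : ut = yt *t xt.
  rewrite (qmon_mul q_neq0) ?row6D; last by rewrite dot_row6; ring.
  by congr (qmon _ (row6 _ _ _ _ _ _) (row6 _ _ _ _ _ _)); ring.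
have vtE : vt = xt *t zt.
  rewrite (qmon_mul q_neq0) ?row6D; last by rewrite dot_row6; ring.
  by congr (qmon _ (row6 _ _ _ _ _ _) (row6 _ _ _ _ _ _)); ring.
have comm a b : List.In a [:: x; y; z] -> List.In b [:: xt; yt; zt] ->
    a *t b = b *t a.
  by case=> [<-|[<-|[<-|[]]]]; case=> [<-|[<-|[<-|[]]]];
    apply: (qmon_commute q_neq0); rewrite !dot_row6; ring.
exact: (core_tetrahedron q_neq0 q_norm weightD r_neq f_norm f_form x_pos y_pos z_pos
  xt_pos yt_pos zt_pos yx xz uE vE uz yv xyt zxt utE vtE uzt yvt comm).
Qed.

Lemma tetrahedron_equation (r s : int) (lambda mu nu : R[i])
    (f : R[i] -> nat -> R[i]) :
  r != -1 ->
  f (lambda * mu) 0%N = f (lambda * nu) 0%N ->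
  (forall x, ps_constant (f x)) \/
  (exists (m : nat) (l : int), (0 < m)%N /\
    forall x n,
      f x n = f x 0%N *
        ps_at_monomial (qdilog (q ^ (- (r + 1) * (m ^ 2)%N%:Z)))
          (q ^ (- (r + 1) * ((m * (m + 1)) %/ 2)%N%:Z) * x ^ l) m n) ->
  let R_ := Rop q f r s in
  R_ (ix 1) (ix 2) (ix 3) lambda *s R_ (ix 1) (ix 4) (ix 5) (lambda * mu)
    *s R_ (ix 2) (ix 4) (ix 6) nu *s R_ (ix 3) (ix 5) (ix 6) mu
  =s
  R_ (ix 3) (ix 5) (ix 6) nu *s R_ (ix 2) (ix 4) (ix 6) mu
    *s R_ (ix 1) (ix 4) (ix 5) (lambda * nu) *s R_ (ix 1) (ix 2) (ix 3) lambda.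
Proof.
move=> r_neq f_norm f_form R_.
have gC e (w t : term q) : positive (h := weight) w -> positive (h := weight) t ->
    graded (h := weight) (Rcore f r e w t).
  by move=> [w_id w_gt0] [t_id t_gt0]; apply: graded_Rcore => //; exact: weightD.
have [X2 Xt2] := wmon123_fix (q := q) r s.
have [Z2 Zt2] := wmon246_356 (q := q) r s.
have [Y2 Yt2] := wmon356_246 (q := q) r s.
have [YE YtE] := gact_wmon246 (q := q) r s.
have [UE UtE] := gact_wmon145 (q := q) r s.
have [VE VtE] := gact2_wmon145 (q := q) r s.
pose X := wmon q r s (ix 1) (ix 2) (ix 3).
pose Xt := wtmon q r s (ix 1) (ix 2) (ix 3).
pose Y := gact F356 (wmon q r s (ix 2) (ix 4) (ix 6)).
pose Yt := gact F356 (wtmon q r s (ix 2) (ix 4) (ix 6)).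
pose Z := wmon q r s (ix 3) (ix 5) (ix 6).
pose Zt := wtmon q r s (ix 3) (ix 5) (ix 6).
pose U := gact F123 (wmon q r s (ix 1) (ix 4) (ix 5)).
pose Ut := gact F123 (wtmon q r s (ix 1) (ix 4) (ix 5)).
pose V := gact (F356 \o F246) (wmon q r s (ix 1) (ix 4) (ix 5)).
pose Vt := gact (F356 \o F246) (wtmon q r s (ix 1) (ix 4) (ix 5)).
have [[Xpos Ypos Zpos] [Xtpos Ytpos Ztpos] [Upos Vpos] [Utpos Vtpos] core] :
   [/\ [/\ positive (h := weight) X, positive (h := weight) Y & positive (h := weight) Z],
       [/\ positive (h := weight) Xt, positive (h := weight) Yt & positive (h := weight) Zt],
       positive (h := weight) U /\ positive (h := weight) V,
       positive (h := weight) Ut /\ positive (h := weight) Vt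
     & sact (h := weight)
        (Rcore f r lambda X Xt *s Rcore f r (lambda * mu) U Ut *s Rcore f r nu Z Zt
           *s Rcore f r mu Y Yt) =
       sact (h := weight)
        (Rcore f r nu Z Zt *s Rcore f r mu Y Yt *s Rcore f r (lambda * nu) V Vt
           *s Rcore f r lambda X Xt)].
  rewrite /X /Xt /Y /Yt /Z /Zt /U /Ut /V /Vt YE YtE UE UtE VE VtE.
  rewrite wmon123E wtmon123E wmon356E wtmon356E.
  exact: qmon_tetrahedron.
apply: (series_eq_twist q_neq0 (h := weight)
  (A0 := Rcore f r lambda X Xt *s Rcore f r (lambda * mu) U Ut *s Rcore f r nu Z Zt
           *s Rcore f r mu Y Yt)
  (B0 := Rcore f r nu Z Zt *s Rcore f r mu Y Yt *s Rcore f r (lambda * nu) V Vt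
           *s Rcore f r lambda X Xt)
  (g := F123 \o F145 \o F246 \o F356)); last exact: core.
- by do ?[exact: gC | exact: weightD | apply: graded_mul].
- by do ?[exact: gC | exact: weightD | apply: graded_mul].
(* The arguments are written back as the images produced by [Rop4_twist]. Z has to come first, as
   the rewritten Y contains the monomial of Z. *)
- rewrite /Z /Zt -Z2 -Zt2 /Y /Yt -Y2 -Yt2.
  by move=> n; apply: Rop4_twist; exact: ix_lt.
- rewrite Faut_tetrahedron /X /Xt -X2 -Xt2.
  by move=> n; apply: Rop4_twist; exact: ix_lt.
Qed.

End TetrahedronEquation.

(* [f_norm] fixes the normalisation of the family f_{q,x}: by comparing the terms
   without any a's or b's, it is also necessary for the tetrahedron equation, and
   it holds in particular if f_{q,x}(0) does not depend on x. *)
Theorem corollary1 (R : realType) (q : R[i]) (r s : int)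
    (lambda mu nu : R[i]) (f : R[i] -> nat -> R[i])
    (q_neq0 : q != 0) (q_norm : `|q| != 1) (r_neq : r != -1)
    (f_inv : forall x, ps_invertible (f x))
    (f_norm : f (lambda * mu) 0%N = f (lambda * nu) 0%N)
    (f_form :
      (forall x, ps_constant (f x)) \/
      (exists (m : nat) (l : int), (0 < m)%N /\
        forall x n,
          f x n = f x 0%N *
            ps_at_monomial (qdilog (q ^ (- (r + 1) * (m ^ 2)%N%:Z)))
              (q ^ (- (r + 1) * ((m * (m + 1)) %/ 2)%N%:Z) * x ^ l) m n)) :
  let R_ := Rop q f r s in
  (forall (i j k : 'I_6) (x : R[i]), (i < j < k)%N ->
     R_ i j k x =s Rop_alt q f r s i j k x) /\
  R_ (ix 1) (ix 2) (ix 3) lambda *s R_ (ix 1) (ix 4) (ix 5) (lambda * mu)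
    *s R_ (ix 2) (ix 4) (ix 6) nu *s R_ (ix 3) (ix 5) (ix 6) mu
  =s
  R_ (ix 3) (ix 5) (ix 6) nu *s R_ (ix 2) (ix 4) (ix 6) mu
    *s R_ (ix 1) (ix 4) (ix 5) (lambda * nu) *s R_ (ix 1) (ix 2) (ix 3) lambda.
Proof.
split=> [i j k x ijk|]; first exact: Rop_Rop_alt.
exact: tetrahedron_equation.
Qed.
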